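(* Every dessin d'enfant is a limit of simple dessins d'enfants in the deformation space: for every $n\ge1$, every element of $\mathfrak{D}_n$ lies in the closure of the set of simple dessins d'enfants in $\mathfrak{D}_n$.
   Context: A completely reducible trigonal curve (CRTC) $C$ is a curve given by $(y-y_1)(y-y_2)(y-y_3)=0$ with $y_1,y_2,y_3\in\mathbb{C}[x]$; its maximal degree is $\max\{\deg y_1,\deg y_2,\deg y_3\}=n\ge 1$. All curves are assumed to have no triple intersections: there is no $x_0\in\mathbb{C}$ with $y_1(x_0)=y_2(x_0)=y_3(x_0)$, and (the same condition over $x=\infty$) the coefficients of $x^n$ in $y_1,y_2,y_3$ are not all equal. Put $\lambda=\frac{y_1-y_3}{y_2-y_3}:P^1\to P^1$ and $j_C=\frac{4(\lambda^2-\lambda+1)^3}{27\lambda^2(\lambda-1)^2}:P^1\to P^1$, where $P^1=\mathbb{C}\cup\{\infty\}$. The dessin d'enfant of $C$ is the embedded graph $\Gamma_C=j_C^{-1}([0,1])\subset P^1$; its $\bullet$-vertices are the points of $j_C^{-1}(0)$ and its $\circ$-vertices are the points of $j_C^{-1}(1)$. Ramification points of $j_C$ with image in $(0,1)$ are called monochrome vertices. A dessin d'enfant is simple if all its $\bullet$-vertices have degree $3$, all its $\circ$-vertices have degree $2$, and it has no monochrome vertex. Let $\mathfrak{T}_n$ be the space of CRTCs of maximal degree $n$, i.e. of triples $(y_1,y_2,y_3)$ of polynomials in $\mathbb{C}[x]$ with $\max\{\deg y_1,\deg y_2,\deg y_3\}=n$, such that there is no $x_0\in\mathbb{C}$ with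 $y_1(x_0)=y_2(x_0)=y_3(x_0)$ and the coefficients of $x^n$ in $y_1,y_2,y_3$ are not all equal, topologized by the coefficients of the polynomials $y_i$. Let $\omega$ be the map sending a curve $C\in\mathfrak{T}_n$ to its dessin $\Gamma_C$, and let $\mathfrak{D}_n=\omega(\mathfrak{T}_n)$ (the deformation space of dessins of maximal degree $n$). Dessins are deformed by continuously changing the coefficients of the $y_i$; accordingly $\mathfrak{D}_n$ carries the quotient topology for $\omega$ (a subset of $\mathfrak{D}_n$ is open if and only if its preimage in $\mathfrak{T}_n$ is open). *)

(* Defs.v *)
From HB Require Import structures.
From mathcomp Require Import all_boot all_order all_algebra.
From mathcomp Require Import all_classical all_reals topology normedtype derive.
From mathcomp Require Export complex.

Set Implicit Arguments.
Unset Strict Implicit.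
Unset Printing Implicit Defensive.

Import Order.TTheory GRing.Theory Num.Theory.
Import numFieldNormedType.Exports.

Local Open Scope classical_set_scope.
Local Open Scope ring_scope.

(* The topology and the normed space structure of C, copied from R[i] viewed as
   an abstract numFieldType. *)
HB.instance Definition _ (T : rcfType) := GRing.ComAlgebra.copy T[i] T[i]^o.
HB.instance Definition _ (T : rcfType) := Vector.copy T[i] T[i]^o.
HB.instance Definition _ (T : rcfType) := NormedModule.copy T[i] T[i]^o.

Section Dessins.
Variable R : realType.
Local Notation C := R[i].

(* P^1 = C + {oo}; [Some z] is the finite point z and [None] is oo. *)
Definition P1 : Type := one_point_compactification C.
HB.instance Definition _ := Topological.copy P1 (one_point_compactification C).

(* The map P^1 -> P^1 given by p/q for coprime p and q; its value at oo is read
   off the coefficients of degree max(deg p, deg q). *)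
Definition ratmap (p q : {poly C}) (x : P1) : P1 :=
  let d := (maxn (size p) (size q)).-1 in
  let: (a, b) := if x is Some z then (p.[z], q.[z]) else (p`_d, q`_d) in
  if b == 0 then None else Some (a / b).

(* Local coordinate at x, sending 0 to x: z |-> x + z at a finite point x, and
   z |-> 1/z at oo. *)
Definition chart (x : P1) (z : C) : P1 :=
  if x is Some x0 then Some (x0 + z) else if z == 0 then None else Some z^-1.

(* Ramification points of f at which f takes a finite value: the derivative
   vanishes in local coordinates. ([odflt 0] forgets that the target is P^1; it
   only matters where f = oo, hence not near such a point.) *)
Definition ramification_point (f : P1 -> P1) (x : P1) : Prop :=
  f x <> None /\
  is_derive (0 : C) (1 : C) (fun z : C => odflt 0 (f (chart x z)) : C) (0 : C).

Record crtc (n : nat) := Crtc {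
  y1 : {poly C};
  y2 : {poly C};
  y3 : {poly C};
  crtc_degree : maxn (size y1) (maxn (size y2) (size y3)) = n.+1;
  crtc_no_triple : ~ exists x : C, y1.[x] = y2.[x] /\ y2.[x] = y3.[x];
  crtc_no_triple_oo : ~ (y1`_n = y2`_n /\ y2`_n = y3`_n)
}.

Definition crtc_coef n (c : crtc n) : 'M[C]_(3, n.+1) :=
  \matrix_(i, j) [:: y1 c; y2 c; y3 c]`_i`_j.

HB.instance Definition _ n := gen_eqMixin (crtc n).
HB.instance Definition _ n := gen_choiceMixin (crtc n).
HB.instance Definition _ n :=
  Topological.copy (crtc n) (initial_topology (@crtc_coef n)).

(* As there are no triple intersections, y1 - y3 and y2 - y3 are coprime, and
   the larger of their degrees is n. *)
Definition lambda n (c : crtc n) : P1 -> P1 :=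
  ratmap (y1 c - y3 c) (y2 c - y3 c).

Definition j_of_lambda : P1 -> P1 :=
  ratmap (4%:R *: ('X^2 - 'X + 1) ^+ 3) (27%:R *: ('X^2 * ('X - 1) ^+ 2)).

Definition jmap n (c : crtc n) : P1 -> P1 := j_of_lambda \o lambda c.

(* A graph embedded in P^1 with its three kinds of vertices. For a dessin of a
   curve the monochrome vertices are determined by the other data (they are the
   points of the graph that are not coloured vertices and near which the
   graph is not an arc), so recording them does not affect equality. *)
Record dessin := Dessin {
  graph : set P1;
  black : set P1;
  white : set P1;
  monochrome : set P1
}.

Definition realP1 (A : set R) : set P1 := [set Some (t%:C)%C | t in A].

Definition omega n (c : crtc n) : dessin := {|
  graph := jmap c @^-1` realP1 `[0, 1];
  black := jmap c @^-1` realP1 [set 0];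
  white := jmap c @^-1` realP1 [set 1];
  monochrome := ramification_point (jmap c) `&` jmap c @^-1` realP1 `]0, 1[
|}.

(* Edges are open, i.e. do not contain their ends. *)
Definition edges (D : dessin) : set (set P1) :=
  let G := graph D `\` (black D `|` white D `|` monochrome D) in
  [set connected_component G x | x in G].

(* The number of edges ending at v is k. In the dessin of a curve there are no
   loops, since j is strictly monotone along each edge. *)
Definition has_degree (D : dessin) (v : P1) (k : nat) : Prop :=
  ([set e | edges D e /\ closure e v] #= `I_k)%card.

Definition simple_dessin (D : dessin) : Prop :=
  [/\ forall v, black D v -> has_degree D v 3,
      forall v, white D v -> has_degree D v 2
    & monochrome D = set0].

Definition dessins (n : nat) : Type := set_type (range (@omega n)).

Definition to_dessins n (c : crtc n) : dessins n :=
  SigSub (mem_set (imageT (@omega n) c)).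

HB.instance Definition _ n := gen_eqMixin (dessins n).
HB.instance Definition _ n := gen_choiceMixin (dessins n).

(* The quotient topology for [to_dessins]. *)
Definition dessins_open n : set_system (dessins n) :=
  [set A | open (@to_dessins n @^-1` A)].

Lemma dessins_openT n : @dessins_open n setT.
Proof. by rewrite /dessins_open/= preimage_setT; exact: openT. Qed.

Lemma dessins_openI n : setI_closed (@dessins_open n).
Proof. by move=> A B oA oB; exact: openI. Qed.

Lemma dessins_open_bigU n (I : Type) (f : I -> set (dessins n)) :
  (forall i, dessins_open (f i)) -> dessins_open (\bigcup_i f i).
Proof. by move=> of_; apply: bigcup_open => i _; exact: of_. Qed.

HB.instance Definition _ n := isOpenTopological.Build (dessins n)
  (@dessins_openT n) (@dessins_openI n) (@dessins_open_bigU n).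

End Dessins.

(* Main.v *)
Require Import Defs.
From mathcomp Require Import all_boot all_order all_algebra.
From mathcomp Require Import all_classical all_reals topology normedtype derive.
From mathcomp Require Import ring lra.

(** Replacing [y1] by [y1 + t (y2 - y3)] replaces [lambda] by [lambda + t]; this
    deformation, with [t] real and small, already suffices to make the dessin of
    any curve simple.

    Let [w] be the Moebius coordinate on the [lambda]-line that sends the two
    zeros of [j] to 0 and infinity. In this coordinate
    [j = 4 w ^ 3 / (1 + w ^ 3) ^ 2], so [j^{-1}([0, 1])] consists of the three
    rays [w ^ 3 >= 0] together with infinity: a theta graph whose vertices are 0
    and infinity (of degree 3, over [j = 0]) and the cube roots of unity (of
    degree 2, over [j = 1]). If [lambda] has no critical point over this theta
    graph, then the dessin, being its preimage under [lambda], is locally a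
    homeomorphic copy of it, and so is simple ([simple_omega]).

    The critical values of [lambda] are finitely many, as they come from the zeros
    of a nonzero Wronskian ([wronskian_neq0]), and the critical points do not
    move with [t]. For a fixed number [s], [s + t] lies on the theta graph for
    finitely many real [t] only, since such [t] are roots of a nonzero polynomial
    ([theta_poly_neq0]). Hence all but finitely many real [t] move the critical
    values off the theta graph, and also the value of [lambda] at infinity, so
    that the dessin lies in the finite plane ([shift_simple]).

    Degrees count connected components of a subspace of the sphere, so two things
    have to be known at a vertex. Locally, the preimage of the star of [m]
    segments must consist of exactly [m] arcs: this is the inverse function
    theorem, obtained here from the factorisation of [A - y B]
    ([horner_quotient_local_inverse]). Globally, different arcs must lie in
    different components: their images lie on different open segments of the
    theta graph, and these are separated by the signs of functions of the form
    [|P| - |Q|] with [P] and [Q] polynomials ([connected_norm_lt]).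
    [card_branches] combines the two. *)

Set Implicit Arguments.
Unset Strict Implicit.
Unset Printing Implicit Defensive.

Import Order.TTheory GRing.Theory Num.Theory.
Import numFieldNormedType.Exports.

Local Open Scope classical_set_scope.
Local Open Scope ring_scope.

(** * Components of a subspace adherent to a point *)

Lemma disjoint_opens_separated (T : topologicalType) (U V : set T) :
  open U -> open V -> U `&` V = set0 -> separated U V.
Proof.
move=> oU oV UV; split; apply/seteqP; split => // x [].
- move=> cU Vx; have [y [Uy Vy]] := cU V (open_nbhs_nbhs (conj oV Vx)).
  have : (U `&` V) y by []. by rewrite UV.
- move=> Ux cV; have [y [Vy Uy]] := cV U (open_nbhs_nbhs (conj oU Ux)).
  have : (U `&` V) y by []. by rewrite UV.
Qed.

Lemma connected_component_eq (T : topologicalType) (G S : set T) (x y : T) :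
  connected S -> S `<=` G -> S x -> S y ->
  connected_component G x = connected_component G y.
Proof.
by move=> cS SG Sx Sy; apply: same_connected_component; exists S.
Qed.

(** The sets [S k] are the germs at [v] of the branches of [G]. A component
    adherent to [v] must enter a neighbourhood of [v], hence meets a branch and
    swallows it; so [k |-> component of S k] enumerates these components, and
    it is injective when no connected part of [G] joins two branches. *)
Lemma card_adherent_components (T : topologicalType) (G : set T) (v : T) (m : nat)
    (S : nat -> set T) :
  (forall k, (k < m)%N -> connected (S k)) ->
  (forall k, (k < m)%N -> S k `<=` G) ->
  (forall k, (k < m)%N -> closure (S k) v) ->
  nbhs v [set x | G x -> exists2 k, (k < m)%N & S k x] ->
  (forall j k K, (j < m)%N -> (k < m)%N -> connected K -> K `<=` G ->
     S j `&` K !=set0 -> S k `&` K !=set0 -> j = k) ->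
  ([set e | [set connected_component G x | x in G] e /\ closure e v] #= `I_m)%card.
Proof.
move=> cS SG adh loc sep.
(* Branches are nonempty because [v] is adherent to them. *)
have S0 k : (k < m)%N -> S k !=set0.
  by move=> km; have [x [Sx _]] := adh _ km setT filterT; exists x.
pose s k := if pselect ((k < m)%N) is left km then projT1 (cid (S0 k km)) else v.
have Ss k : (k < m)%N -> S k (s k).
  by move=> km; rewrite /s; case: pselect => // ?; case: cid.
pose e k := connected_component G (s k).
have Se k : (k < m)%N -> S k `<=` e k.
  move=> km; apply: connected_component_max; [exact: Ss|exact: SG|exact: cS].
have -> : [set f | [set connected_component G x | x in G] f /\ closure f v] = e @` `I_m.
  apply/seteqP; split => [_ [[x Gx <-]] cv|_ [k /= km <-]].
    have [y [Cy /(_ (connected_component_sub Cy)) [k km Sy]]] := cv _ loc.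
    exists k => //; rewrite /e (same_connected_component Cy).
    by apply: (connected_component_eq (cS k km) (SG k km)) => //; exact: Ss.
  split; first by exists (s k) => //; apply: (SG k) => //; exact: Ss.
  exact/closureS/adh/km/Se.
apply: inj_card_eq => j k /set_mem /= jm /set_mem /= km ejk.
apply: (sep j k (e j)) => //; first exact: component_connected.
- exact: connected_component_sub.
- by exists (s j); split; [exact: Ss|apply: Se => //; exact: Ss].
- by exists (s k); split; [exact: Ss|rewrite ejk; apply: Se => //; exact: Ss].
Qed.

(** * Local inverses of rational functions *)

Section LocalInverse.
Variable K : numClosedFieldType.
Implicit Types (A B p : {poly K}) (v x y : K).

(** A substitute for the minimum, the order of [K] being partial. *)
Lemma pos_common_lower_bound (a b : K) : 0 < a -> 0 < b ->
  exists2 d, 0 < d & d <= a /\ d <= b.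
Proof.
move=> a0 b0; have ab0 : 0 < a + b by rewrite addr_gt0.
exists (a * b / (a + b)); first by rewrite divr_gt0// mulr_gt0.
by split; rewrite ler_pdivrMr// mulrDr 1?mulrC ?lerDr ?lerDl mulr_ge0// ltW.
Qed.

Lemma continuous_horner p : continuous (horner p : K -> K).
Proof.
elim/poly_ind: p => [|p c ih] x.
  have -> : horner 0 = cst 0 :> (K -> K) by apply/funext => y; rewrite horner0.
  exact: cst_continuous.
have -> : horner (p * 'X + c%:P) = (fun y => p.[y] * y + c).
  by apply/funext => y; rewrite !hornerE.
apply: (@continuousD K K^o K (fun y => p.[y] * y) (cst c)); last exact: cst_continuous.
by apply: (@continuousM K K (fun y => p.[y]) id); [exact: ih|exact: cvg_id].
Qed.

(** The difference quotient of a polynomial is a continuous function of two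
    variables whose diagonal is the derivative: an exact form of strict
    differentiability. *)
Lemma horner_slope p : exists2 q : K * K -> K, continuous q &
  forall x y, p.[x] - p.[y] = (x - y) * q (x, y) /\ q (x, x) = p^`().[x].
Proof.
elim/poly_ind: p => [|p c [q cq qE]].
  exists (cst 0); first exact: cst_continuous.
  by move=> x y; rewrite deriv0 !horner0 /= subrr mulr0.
exists (fun z => q z * z.1 + p.[z.2]).
  move=> z; apply: (@continuousD K K^o (K * K)%type (fun z => q z * z.1) (fun z => p.[z.2])).
    apply: (@continuousM K (K * K)%type q fst); first exact: cq.
    exact: cvg_fst.
  apply: (@continuous_comp (K * K)%type K K snd (horner p)).
    exact: cvg_snd.
  exact: continuous_horner.
move=> x y; have [pE qx] := qE x y; split.
  by rewrite !hornerE /= mulrDr mulrA -pE; ring.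
by rewrite /= qx derivD derivM derivX derivC !hornerE.
Qed.

(** [A x B y - A y B x = (x - y) k(x, y)] with [k] continuous and [k(v, v)] the
    Wronskian at [v]; so where the Wronskian does not vanish, [A / B] is locally
    expanding up to a constant factor, in particular injective. *)
Lemma horner_quotient_expanding A B v : B.[v] != 0 ->
    (A^`() * B - A * B^`()).[v] != 0 ->
  exists r c : K, [/\ 0 < r, 0 < c,
    forall x, `|x - v| < r -> B.[x] != 0 &
    forall x y, `|x - v| < r -> `|y - v| < r ->
      c * `|x - y| <= `|A.[x] / B.[x] - A.[y] / B.[y]|].
Proof.
move=> Bv Wv; have [a ca aE] := horner_slope A; have [b cb bE] := horner_slope B.
pose k (z : K * K) := a z * B.[z.2] - A.[z.2] * b z.
have kE x y : A.[x] * B.[y] - A.[y] * B.[x] = (x - y) * k (x, y).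
  have [aE1 _] := aE x y; have [bE1 _] := bE x y.
  have -> : A.[x] * B.[y] - A.[y] * B.[x] =
     (A.[x] - A.[y]) * B.[y] - A.[y] * (B.[x] - B.[y]) by ring.
  by rewrite aE1 bE1 /k /=; ring.
have csnd p : continuous (fun z : K * K => p.[z.2]).
  move=> z; apply: (@continuous_comp (K * K)%type K K snd (horner p)).
    exact: cvg_snd.
  exact: continuous_horner.
have ck : continuous k.
  move=> z; apply: (@continuousB K K^o (K * K)%type).
    by apply: (@continuousM K (K * K)%type a); [exact: ca|exact: csnd].
  by apply: (@continuousM K (K * K)%type _ b); [exact: csnd|exact: cb].
pose w := `|(A^`() * B - A * B^`()).[v]| / 2.
have w0 : 0 < w by rewrite divr_gt0// normr_gt0.
have kv : k (v, v) = (A^`() * B - A * B^`()).[v].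
  by rewrite /k /= (aE v v).2 (bE v v).2 !hornerE.
have near_k : \forall z \near (v, v), `|k (v, v) - k z| < w.
  exact: (@cvgr_dist_lt K K (K * K)%type _ _ k _ (ck (v, v)) _ w0).
have Bv0 : 0 < `|B.[v]| / 2 by rewrite divr_gt0// normr_gt0.
have near_B : \forall z \near (v, v), `|B.[v] - B.[z.2]| < `|B.[v]| / 2.
  exact: (@cvgr_dist_lt K K (K * K)%type _ _ _ _ (csnd B (v, v)) _ Bv0).
have [r /= r0 rP] := (@nbhs_ballP K (K * K)%type (v, v) _).1 (filterI near_k near_B).
have normB x : `|x - v| < r -> `|B.[v] - B.[x]| < `|B.[v]| / 2.
  move=> xv; suff /rP[] : ball (v, v) r (x, x) by [].
  by split; rewrite -ball_normE /= distrC.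
have B0 x : `|x - v| < r -> B.[x] != 0.
  move=> /normB; apply: contraTneq => ->; rewrite subr0.
  by rewrite -real_leNgt ?realE ?normr_ge0 ?(ltW Bv0)// ler_pdivrMr// ler_peMr// ler1n.
have Bmax x : `|x - v| < r -> `|B.[x]| <= 2 * `|B.[v]|.
  move=> /normB /ltW; rewrite distrC => h.
  have := ler_normD (B.[x] - B.[v]) B.[v]; rewrite subrK => /le_trans; apply.
  by rewrite mulr_natl mulr2n lerD2r (le_trans h)// ler_pdivrMr// ler_peMr// ler1n.
(* [|k| >= w] and [|B| <= 2 |B v|] near [v], whence this expansion factor. *)
pose c := w / (2 * `|B.[v]|) ^+ 2.
have M0 : 0 < 2 * `|B.[v]| by rewrite mulr_gt0// normr_gt0.
have c0 : 0 < c by rewrite /c divr_gt0// exprn_gt0.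
exists r; exists c; split => //.
move=> x y xv yv; have [Bx By] := (B0 x xv, B0 y yv).
have -> : A.[x] / B.[x] - A.[y] / B.[y] = (x - y) * k (x, y) / (B.[x] * B.[y]).
  by rewrite -kE; field; rewrite Bx By.
rewrite normrM normrM normfV -mulrA mulrC ler_wpM2l//.
rewrite /c ler_pM//.
- exact: ltW.
- by rewrite invr_ge0 exprn_ge0// ltW.
- have /rP[+ _] : ball (v, v) r (x, y) by split; rewrite -ball_normE /= distrC.
  move=> /= /ltW h.
  have := ler_normD (k (v, v) - k (x, y)) (k (x, y)); rewrite subrK kv => h2.
  have : w + w <= w + `|k (x, y)|.
    have -> : w + w = `|(A^`() * B - A * B^`()).[v]| by rewrite /w -splitr.
    by apply: (le_trans h2); rewrite lerD2r -kv.
  by rewrite lerD2l.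
- rewrite normrM lef_pV2 ?posrE ?exprn_gt0 ?mulr_gt0 ?normr_gt0//.
  by rewrite expr2 ler_pM// Bmax.
Qed.

(** If all roots were at distance at least [r] from [v], the factorisation of [p]
    would give [|p.[v]| >= |lead| * r ^ n]. *)
Lemma root_close_to_pseudoroot p n v (d r : K) : (size p <= n.+1)%N ->
  d <= `|p`_n| -> 0 < d -> 0 <= r -> `|p.[v]| < d * r ^+ n ->
  exists2 x, root p x & `|x - v| < r.
Proof.
move=> sp dp d0 r0 pv.
have pn0 : p`_n != 0 by rewrite -normr_gt0 (lt_le_trans d0).
have szp : size p = n.+1.
  apply/eqP; rewrite eqn_leq sp ltnNge; apply: contra pn0 => szp.
  by rewrite nth_default.
have [s ps] := closed_field_poly_normal p.
have lcp : lead_coef p = p`_n by rewrite lead_coefE szp.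
have szs : size s = n.
  apply/succn_inj; rewrite -szp ps size_scale ?size_prod_XsubC//.
  by rewrite lcp.
apply: contrapT => noroot.
suff : d * r ^+ n <= `|p.[v]|.
  have dr0 : 0 <= d * r ^+ n by rewrite mulr_ge0 ?exprn_ge0// ltW.
  by rewrite real_leNgt ?realE ?dr0 ?normr_ge0// pv.
rewrite ps hornerZ normrM lcp ler_pM ?exprn_ge0//; first exact: ltW.
have -> : r ^+ n = \prod_(x <- s) r.
  by rewrite -szs; elim: (s) => [|x s' ih]; rewrite ?big_nil ?big_cons ?expr0//= exprS ih.
rewrite horner_prod normr_prod.
rewrite big_seq [leRHS]big_seq ler_prod// => x xs.
rewrite r0 hornerXsubC distrC real_leNgt ?realE ?r0 ?normr_ge0//=.
apply/negP => xv; apply: noroot; exists x => //.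
by rewrite ps rootZ ?lcp// root_prod_XsubC.
Qed.

(** Holomorphic inverse function theorem for [A / B], by algebra: the solutions
    of [A / B = y] are the roots of [A - y B]. At [v] this polynomial is small
    when [y] is close to [w = A.[v] / B.[v]], so it has a root near [v], provided
    its coefficient of degree [n] stays away from 0, that is, provided [A / B]
    does not take the value [w] at infinity. The expansion property makes that
    root unique and the inverse Lipschitz. *)
Lemma horner_quotient_local_inverse A B n v : (size A <= n.+1)%N -> (size B <= n.+1)%N ->
    B.[v] != 0 -> (A^`() * B - A * B^`()).[v] != 0 ->
    A`_n != A.[v] / B.[v] * B`_n ->
  exists r d c : K, exists s : K -> K, [/\ 0 < r, 0 < d, 0 < c,
    [/\ forall x, `|x - v| < r -> B.[x] != 0,
        forall y, `|y - A.[v] / B.[v]| < d ->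
          `|s y - v| < r /\ A.[s y] / B.[s y] = y &
        forall x, `|x - v| < r -> `|A.[x] / B.[x] - A.[v] / B.[v]| < d ->
          s (A.[x] / B.[x]) = x] &
    forall y z, `|y - A.[v] / B.[v]| < d -> `|z - A.[v] / B.[v]| < d ->
      c * `|s y - s z| <= `|y - z|].
Proof.
move=> sA sB Bv Wv ABn.
have [r [c [r0 c0 B0 wP]]] := horner_quotient_expanding Bv Wv.
set w := A.[v] / B.[v] in ABn *.
pose e := `|A`_n - w * B`_n| / 2.
have e0 : 0 < e by rewrite divr_gt0// normr_gt0 subr_eq0.
have [d d0 [d1 d2]] : exists2 d, 0 < d &
    d <= e / (`|B`_n| + 1) /\ d <= e * r ^+ n / (`|B.[v]| + 1).
  apply: pos_common_lower_bound; first by rewrite divr_gt0// ltr_wpDl.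
  by apply: divr_gt0; [apply: mulr_gt0 => //; exact: exprn_gt0|exact: ltr_wpDl].
have sec y : exists x, `|y - w| < d -> `|x - v| < r /\ A.[x] / B.[x] = y.
  have [yw|yw] := boolP (`|y - w| < d); last by exists 0.
  have y1 : `|w - y| < e / (`|B`_n| + 1) by rewrite distrC; exact: lt_le_trans d1.
  have y2 : `|w - y| < e * r ^+ n / (`|B.[v]| + 1) by rewrite distrC; exact: lt_le_trans d2.
  have bnd (a b : K) : 0 <= a -> `|w - y| < b / (a + 1) -> `|w - y| * a <= b.
    move=> a0; rewrite ltr_pdivlMr ?ltr_wpDl// => /ltW; apply: le_trans.
    by rewrite ler_wpM2l// lerDl.
  have [||//|||x /eqP] := @root_close_to_pseudoroot (A - y *: B) n v e r.
  - apply: leq_trans (size_polyD _ _) _; rewrite geq_max sA size_polyN.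
    exact: leq_trans (size_scale_leq _ _) _.
  - rewrite coefB coefZ.
    have := ler_normD (A`_n - y * B`_n) ((y - w) * B`_n).
    have -> : A`_n - y * B`_n + (y - w) * B`_n = A`_n - w * B`_n by ring.
    move=> h; have : e + e <= `|A`_n - y * B`_n| + e.
      rewrite {1 2}/e -splitr (le_trans h)// lerD2l normrM distrC; exact: bnd.
    by rewrite lerD2r.
  - exact: ltW.
  - rewrite hornerD hornerN hornerZ.
    have -> : A.[v] - y * B.[v] = (w - y) * B.[v] by rewrite mulrBl /w divfK.
    rewrite normrM; move: y2; rewrite ltr_pdivlMr ?ltr_wpDl//; apply: le_lt_trans.
    by rewrite ler_wpM2l// lerDl.
  rewrite hornerD hornerN hornerZ => /eqP; rewrite subr_eq0 => /eqP Ax xv.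
  by exists x => _; split => //; rewrite Ax mulfK// B0.
have [s sP] := choice sec.
exists r; exists d; exists c; exists s; split => //; first split => //.
  move=> x xv wxd; have [sv ws] := sP _ wxd.
  have := wP _ _ sv xv; rewrite ws subrr normr0 pmulr_rle0// normr_le0 subr_eq0.
  by move=> /eqP.
move=> y z yw zw; have [sy wy] := sP _ yw; have [sz wz] := sP _ zw.
by have := wP _ _ sy sz; rewrite wy wz.
Qed.

End LocalInverse.

(** * Branches of the preimage of a star *)

Lemma continuous_Re (R : realType) : continuous (@complex.Re R : R[i] -> R).
Proof.
move=> z; apply/(@cvgrPdist_lt R R R[i] (nbhs z) (nbhs_filter z)) => e e0.
have e0' : 0 < (e%:C)%C :> R[i] by rewrite ltcR.
apply: filterS (nbhsx_ballx z _ e0') => w; rewrite -ball_normE /= => zw.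
by rewrite -raddfB -ltcR; exact: le_lt_trans (normc_ge_Re _) zw.
Qed.

Section Branches.
Variable R : realType.
Local Notation C := R[i].
Implicit Types (A B P Q : {poly C}) (x y z v w : C).

(** The real function [|P| - |Q|] is continuous and has no zero on a connected
    set, so its sign is constant there. *)
Lemma connected_norm_lt P Q (K : set (P1 R)) x y :
    connected K -> K `<=` Some @` [set z | `|P.[z]| != `|Q.[z]|] ->
    K (Some x) -> K (Some y) ->
  `|Q.[x]| < `|P.[x]| -> `|Q.[y]| < `|P.[y]|.
Proof.
move=> cK KPQ Kx Ky xlt.
pose h z : R := complex.Re `|P.[z]| - complex.Re `|Q.[z]|.
have cnorm S : continuous (fun z : C => complex.Re `|S.[z]|).
  move=> z; apply: (@continuous_comp C C R (fun z => `|S.[z]|) (@complex.Re R)).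
    apply: (@continuous_comp C C C (horner S) Num.norm).
      exact: continuous_horner.
    exact: (@norm_continuous C C).
  exact: continuous_Re.
have ch : continuous h.
  move=> z; apply: (@continuousB R R C (fun z => complex.Re `|P.[z]|)
    (fun z => complex.Re `|Q.[z]|));
  exact: cnorm.
have hE z : (`|Q.[z]| < `|P.[z]|) = (0 < h z).
  by rewrite subr_gt0 -ltcR !RRe_real ?normr_real.
have opn (D : set R) : open D -> open (Some @` (h @^-1` D) : set (P1 R)).
  move=> oD; apply: one_point_compactification_open_some.
  by apply: open_comp => // z _; exact: ch.
have sep : separated (Some @` (h @^-1` [set t | 0 < t]) : set (P1 R))
                     (Some @` (h @^-1` [set t | t < 0])).
  apply: disjoint_opens_separated; [exact/opn/open_gt|exact/opn/open_lt|].
  apply/seteqP; split => // _ [[z /= z0 <-] [z' /= z'0 [zz']]].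
  by move: z0; rewrite -zz' => /(lt_trans z'0); rewrite ltxx.
have cov : K `<=` Some @` (h @^-1` [set t | 0 < t]) `|` Some @` (h @^-1` [set t | t < 0]).
  move=> p Kp; have [z /= PQz pE] := KPQ _ Kp.
  have : h z != 0.
    apply: contra PQz; rewrite subr_eq0 => /eqP e.
    by rewrite -(RRe_real (normr_real P.[z])) -(RRe_real (normr_real Q.[z])) e.
  by rewrite neq_lt => /orP[h0|h0]; [right|left]; exists z.
move: xlt; rewrite !hE => hx.
have [sub|sub] := connected_subset sep cov cK.
  by have [z /= hz [<-]] := sub _ Ky.
by have [z /= hz [zx]] := sub _ Kx; move: hx; rewrite -zx => /(lt_trans hz); rewrite ltxx.
Qed.

Lemma nbhs_ballR (z : C) (U : set C) : nbhs z U ->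
  exists2 e : R, 0 < e & forall y, `|y - z| < (e%:C)%C -> U y.
Proof.
move=> /(@nbhs_ballP C C z U)[e /= e0 eU].
have eE : ((complex.Re e)%:C)%C = e by rewrite RRe_real// gtr0_real.
exists (complex.Re e); first by rewrite -ltcR eE.
by move=> y yz; apply: eU; rewrite -ball_normE /= distrC -eE.
Qed.

Lemma continuous_quotient A B v : B.[v] != 0 ->
  {for v, continuous (fun z : C => A.[z] / B.[z] : C)}.
Proof.
move=> Bv; apply: (@continuousM C C (horner A) (fun z => (B.[z])^-1)).
  exact: continuous_horner.
apply: (@continuousV C C (horner B)) => //.
exact: continuous_horner.
Qed.

Definition quotient_preimage A B (D : set C) : set (P1 R) :=
  Some @` [set z | B.[z] != 0 /\ D (A.[z] / B.[z])].

(** Suppose that near [w0] the set [D] is the union of [m] segments issuing from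
    [w0] in the directions [dir k]. The local inverse of [A / B] at [v] lifts
    them to [m] branches of the preimage of [D] at [v], and these are all
    branches there. It remains to know that no connected set joins two lifts,
    which is the last hypothesis. *)
Lemma card_branches A B n v w0 (D : set C) (m : nat) (dir : nat -> C) (d0 : R) :
    (size A <= n.+1)%N -> (size B <= n.+1)%N ->
    B.[v] != 0 -> (A^`() * B - A * B^`()).[v] != 0 ->
    A.[v] / B.[v] = w0 -> A`_n != w0 * B`_n ->
    0 < d0 -> (forall k, (k < m)%N -> `|dir k| = 1) ->
    (forall k (r : R), (k < m)%N -> 0 < r < d0 -> D (w0 + (r%:C)%C * dir k)) ->
    (forall y, D y -> `|y - w0| < (d0%:C)%C ->
       exists2 k, (k < m)%N & exists2 r : R, 0 < r & y = w0 + (r%:C)%C * dir k) ->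
    (forall j k (r r' : R) x y (K : set (P1 R)), (j < m)%N -> (k < m)%N ->
       0 < r < d0 -> 0 < r' < d0 ->
       connected K -> K `<=` quotient_preimage A B D -> K (Some x) -> K (Some y) ->
       A.[x] / B.[x] = w0 + (r%:C)%C * dir j ->
       A.[y] / B.[y] = w0 + (r'%:C)%C * dir k -> j = k) ->
  ([set e | [set connected_component (quotient_preimage A B D) x
              | x in quotient_preimage A B D] e
     /\ closure e (Some v)] #= `I_m)%card.
Proof.
move=> sA sB Bv Wv <-{w0}; set G := quotient_preimage A B D.
pose w z := A.[z] / B.[z]; rewrite -/(w v) => ABn d00 dir1 DS DD sep.
have [r0 [d1 [c [s [r00 d10 c0 [B0 wsP swP] sL]]]]] :=
  horner_quotient_local_inverse sA sB Bv Wv ABn.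
have realE (z : C) : 0 < z -> exists2 e : R, 0 < e & z = (e%:C)%C.
  move=> z0; have zE : ((complex.Re z)%:C)%C = z by rewrite RRe_real// gtr0_real.
  by exists (complex.Re z) => //; rewrite -ltcR zE.
have [r1 r10 r0E] := realE _ r00; have [d2 d20 d1E] := realE _ d10.
have [c1 c10 cE] := realE _ c0; subst r0 d1 c.
pose d := Num.min d0 d2.
have dpos : 0 < d by rewrite lt_min d00.
have dd0 : d <= d0 by rewrite ge_min lexx.
have dd2 : d <= d2 by rewrite ge_min lexx orbT.
(* The segment in direction [k], whose image under the local inverse [s] is the branch. *)
pose path k (r : R) : C := w v + (r%:C)%C * dir k.
have pathd k r r' : (k < m)%N -> `|path k r - path k r'| = (`|r - r'|%:C)%C.
  move=> km; rewrite /path opprD addrACA subrr add0r -mulrBl normrM dir1// mulr1.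
  by rewrite -rmorphB /= normc_def /= expr0n addr0 sqrtr_sqr.
have path0 k : path k 0 = w v by rewrite /path mul0r addr0.
have pathlt k r : (k < m)%N -> 0 < r < d -> `|path k r - w v| < (d2%:C)%C.
  move=> km /andP[r_gt0 rd]; rewrite -(path0 k) pathd// subr0 ltcR gtr0_norm//.
  exact: lt_le_trans dd2.
have sv : s (w v) = v by apply: swP; rewrite subrr normr0.
pose S k : set (P1 R) := [set Some (s (path k r)) | r in [set r : R | 0 < r < d]].
have sclose k r r' (e : R) : (k < m)%N -> `|path k r - w v| < (d2%:C)%C ->
    `|path k r' - w v| < (d2%:C)%C -> `|r - r'| < c1 * e ->
    `|s (path k r) - s (path k r')| < (e%:C)%C.
  move=> km p1 p2 rr; have := sL _ _ p1 p2; rewrite pathd// => le1.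
  have : (c1%:C)%C * `|s (path k r) - s (path k r')| < (c1%:C)%C * (e%:C)%C.
    by rewrite (le_lt_trans le1)// -rmorphM ltcR.
  by rewrite ltr_pM2l.
apply: (@card_adherent_components _ G (Some v) m S).
- move=> k km; apply: connected_continuous_connected.
    have -> : [set r : R | 0 < r < d] = `]0, d[%classic.
      by apply/seteqP; split => r /=; rewrite in_itv.
    exact/connected_intervalP/interval_is_interval.
  apply/continuous_in_subspaceT => r /set_mem /= rd.
  move=> U /= /(@nbhs_ballR (s (path k r)) (Some @^-1` U))[e e0 eU].
  have ce0 : 0 < c1 * e by rewrite mulr_gt0.
  have : \forall t \near r, `|r - t| < c1 * e /\ 0 < t < d.
    near=> t; split.
      by near: t; exact: (@cvgr_dist_lt R R R (nbhs r) _ id r cvg_id _ ce0).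
    apply/andP; split; near: t.
      by apply: lt_nbhsr; case/andP: rd.
    by apply: lt_nbhsl; case/andP: rd.
  apply: filterS => t [rt td]; apply: eU.
  by apply: sclose; rewrite ?pathlt// distrC.
- move=> k km _ [r /= rd <-]; have [h1 h2] := wsP _ (pathlt k r km rd).
  exists (s (path k r)) => //; split; first exact: B0.
  rewrite /w h2; apply: DS => //.
  by case/andP: rd => -> rd; exact: lt_le_trans dd0.
- move=> k km U /(@nbhs_ballR v (Some @^-1` U))[e e0 eU].
  pose r := Num.min d (c1 * e) / 2.
  have r_gt0 : 0 < r by rewrite divr_gt0// lt_min dpos mulr_gt0.
  have rm : r < Num.min d (c1 * e) by rewrite gtr_pMr ?invf_lt1 ?ltr1n// lt_min dpos mulr_gt0.
  have [rd re] : r < d /\ r < c1 * e by move: rm; rewrite lt_min => /andP[].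
  have rr : 0 < r < d by rewrite r_gt0.
  exists (Some (s (path k r))); split; first by exists r.
  apply: eU; rewrite -[X in _ - X]sv -(path0 k); apply: sclose => //.
  + exact: pathlt.
  + by rewrite path0 subrr normr0.
  + by rewrite subr0 gtr0_norm.
- have dC : 0 < (d%:C)%C :> C by rewrite ltcR.
  have near1 : \forall z \near v, `|w v - w z| < (d%:C)%C.
    exact: (@cvgr_dist_lt C C C (nbhs v) _ w _ (continuous_quotient Bv) _ dC).
  have near2 : \forall z \near v, `|v - z| < (r1%:C)%C.
    exact: (@cvgr_dist_lt C C C (nbhs v) _ id _ cvg_id _ r00).
  have : nbhs v (Some @^-1` [set x | G x -> exists2 k, (k < m)%N & S k x]); last by [].
  apply: filterS2 near1 near2 => z; rewrite distrC => wz; rewrite distrC => vz.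
  move=> [z' [Bz Dz] [zE]]; subst z'.
  have wz0 : `|w z - w v| < (d0%:C)%C by rewrite (lt_le_trans wz)// lecR.
  have [k km [r r_gt0 rE]] := DD _ Dz wz0.
  have wE : w z = w v + (r%:C)%C * dir k by [].
  exists k => //; exists r => /=.
    rewrite r_gt0 -ltcR (le_lt_trans _ wz)// wE -/(path k r) -(path0 k) pathd//.
    by rewrite subr0 gtr0_norm.
  by rewrite /path -rE swP// (lt_le_trans wz)// lecR.
- move=> j k K jm km cK KG [_ [[r /= rd <-] Kx]] [_ [[r' /= rd' <-] Ky]].
  have dlt t : 0 < t < d -> 0 < t < d0.
    by case/andP => -> td; exact: lt_le_trans dd0.
  apply: (sep j k r r' _ _ K jm km (dlt _ rd) (dlt _ rd') cK KG Kx Ky).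
    by have [_] := wsP _ (pathlt j r jm rd).
  by have [_] := wsP _ (pathlt k r' km rd').
Unshelve. all: by end_near. Qed.

End Branches.

(** * The star of the cube roots of unity *)
Section Star.
Variable R : realType.
Local Notation C := R[i].
Implicit Types (A B : {poly C}) (x y z v w : C).

Let t3 : R := Num.sqrt 3.

Let t3_sqr : t3 ^+ 2 = 3. Proof. by rewrite sqr_sqrtr. Qed.

(** The cube roots of unity. *)
Definition cbrt1 (k : nat) : C :=
  match k with
  | 0 => 1
  | 1 => Complex (- 2^-1) (t3 / 2)
  | _ => Complex (- 2^-1) (- (t3 / 2))
  end.

Lemma cbrt1_cube k : cbrt1 k ^+ 3 = 1.
Proof.
case: k => [|[|k]]; first by rewrite expr1n.
  apply/eqP; rewrite !exprS expr0 mulr1 eq_complex /=; apply/andP; split; apply/eqP.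
    by field: t3_sqr.
  by field: t3_sqr.
apply/eqP; rewrite !exprS expr0 mulr1 eq_complex /=; apply/andP; split; apply/eqP.
  by field: t3_sqr.
by field: t3_sqr.
Qed.

Lemma norm_cbrt1 k : `|cbrt1 k| = 1.
Proof.
apply/eqP; rewrite -(@pexpr_eq1 _ _ 3)//.
by rewrite -normrX cbrt1_cube normr1.
Qed.

(** Three open rays from 0 in the directions of the cube roots of unity, deprived
    of these roots. In the coordinate [w] in which the symmetries of [j] are
    generated by [w |-> zeta w] and [w |-> 1 / w], this is [j^{-1}(]0, 1[)]. *)
Definition star : set C := [set w | 0 < w ^+ 3 /\ w ^+ 3 != 1].

Lemma cube_eq1 w : w ^+ 3 = 1 -> exists2 k, (k < 3)%N & w = cbrt1 k.
Proof.
move=> w3; have : (w - cbrt1 0) * (w - cbrt1 1) * (w - cbrt1 2) = 0.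
  have c2 : cbrt1 2 = -1 - cbrt1 1.
    by apply/eqP; rewrite eq_complex /=; apply/andP; split; apply/eqP; field.
  have c1 : cbrt1 1 ^+ 2 = -1 - cbrt1 1.
    rewrite expr2; apply/eqP; rewrite eq_complex /=; apply/andP; split; apply/eqP;
    by field: t3_sqr.
  rewrite c2 (_ : cbrt1 0 = 1)//; ring: w3 c1.
move=> /eqP; rewrite !mulf_eq0 !subr_eq0 => /orP[/orP[]|] /eqP ->.
- by exists 0%N.
- by exists 1%N.
- by exists 2%N.
Qed.

Lemma cube_gt0 w : 0 < w ^+ 3 ->
  exists2 k, (k < 3)%N & exists2 r : R, 0 < r & w = (r%:C)%C * cbrt1 k.
Proof.
move=> w3; have w0 : w != 0 by apply: contraTneq w3 => ->; rewrite expr0n ltxx.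
have nw : `|w| != 0 by rewrite normr_eq0.
have : (w / `|w|) ^+ 3 = 1.
  by rewrite expr_div_n -normrX gtr0_norm// divff// gt_eqF.
move=> /cube_eq1[k k3 wk]; exists k => //.
have rE : ((complex.Re `|w|)%:C)%C = `|w| by rewrite RRe_real// normr_real.
exists (complex.Re `|w|); first by rewrite -ltcR rE normr_gt0.
by rewrite rE -wk mulrC divfK.
Qed.

Lemma ray_cube (r : R) k : ((r%:C)%C * cbrt1 k) ^+ 3 = ((r ^+ 3)%:C)%C.
Proof. by rewrite exprMn cbrt1_cube mulr1 -rmorphXn. Qed.

Lemma star_ray (r : R) k : 0 < r -> r != 1 -> star ((r%:C)%C * cbrt1 k).
Proof.
move=> r0 r1; rewrite /star /= ray_cube ltcR exprn_gt0//; split => //.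
rewrite -(rmorph1 (real_complex R)) (inj_eq (@complexI R)).
by rewrite pexpr_eq1// ltW.
Qed.

Lemma norm_lt_sqr z w : (`|z| < `|w|) =
  (complex.Re z ^+ 2 + complex.Im z ^+ 2 < complex.Re w ^+ 2 + complex.Im w ^+ 2).
Proof. by rewrite -ltcR !add_Re2_Im2 ltr_pXn2r ?nnegrE. Qed.

(** A ray is distinguished from the two others by the sign of the real part of
    [w * conj zeta], that is, by which of [zeta] and [- zeta] is closer to [w]. *)
Lemma ray_side (r : R) j k : 0 < r -> (j < 3)%N -> (k < 3)%N ->
  if j == k then `|(r%:C)%C * cbrt1 j - cbrt1 k| < `|(r%:C)%C * cbrt1 j + cbrt1 k|
  else `|(r%:C)%C * cbrt1 j + cbrt1 k| < `|(r%:C)%C * cbrt1 j - cbrt1 k|.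
Proof.
move=> r0; case: j => [|[|[|//]]]; case: k => [|[|[|//]]] _ _ /=;
  rewrite norm_lt_sqr /=; have := t3_sqr; nra.
Qed.

Notation star_preimage A B := (quotient_preimage A B star).

(** The star is invariant under [w |-> 1 / w]. *)
Lemma star_preimage_sym A B : star_preimage A B = star_preimage B A.
Proof.
suff H P Q : star_preimage P Q `<=` star_preimage Q P by apply/seteqP; split; exact: H.
move=> _ [z [Qz [pos ne1]] <-]; exists z => //.
have Pz : P.[z] != 0 by apply: contraTneq pos => ->; rewrite mul0r expr0n ltxx.
split=> //; rewrite -invf_div /star /= exprVn invr_gt0 invr_eq1; split=> //.
Qed.

(** The star does not meet the unit circle. *)
Lemma star_preimage_norm A B (K : set (P1 R)) :
  K `<=` star_preimage A B -> K `<=` Some @` [set z | `|A.[z]| != `|B.[z]|].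
Proof.
move=> KG p /KG[z [Bz [pos ne1]] <-]; exists z => //=.
apply: contra ne1 => /eqP AB; have [k _ [r r0 rE]] := cube_gt0 pos.
rewrite rE ray_cube; suff -> : r = 1 by rewrite expr1n.
apply: complexI; rewrite rmorph1.
have : `|A.[z] / B.[z]| = 1 by rewrite normf_div AB divff// normr_eq0.
by rewrite rE normrM norm_cbrt1 mulr1 gtr0_norm// ltcR.
Qed.

Lemma star_preimage_ray A B (K : set (P1 R)) k : (k < 3)%N ->
  K `<=` star_preimage A B ->
  K `<=` Some @` [set z | `|(A + cbrt1 k *: B).[z]| != `|(A - cbrt1 k *: B).[z]|].
Proof.
move=> k3 KG p /KG[z [Bz [pos ne1]] <-]; exists z => //=.
have [j j3 [r r0 rE]] := cube_gt0 pos.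
have := ray_side r0 j3 k3; rewrite -rE !hornerE => side.
have -> : A.[z] = A.[z] / B.[z] * B.[z] by rewrite divfK.
rewrite -mulrDl -mulrBl !normrM (inj_eq (mulIf _)) ?normr_eq0//.
by case: eqP side => _ side; [rewrite gt_eqF|rewrite lt_eqF].
Qed.

(** Lets the branches at a zero of [A] be told apart globally: a connected part
    of the preimage of the star lies over a single ray. *)
Lemma connected_same_ray A B (K : set (P1 R)) x y (r r' : R) j k :
  connected K -> K `<=` star_preimage A B -> K (Some x) -> K (Some y) ->
  (j < 3)%N -> (k < 3)%N -> 0 < r -> 0 < r' ->
  A.[x] / B.[x] = (r%:C)%C * cbrt1 j -> A.[y] / B.[y] = (r'%:C)%C * cbrt1 k -> j = k.
Proof.
move=> cK KG Kx Ky j3 k3 r0 r'0 wx wy.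
have BK z : K (Some z) -> B.[z] != 0 by move=> /KG[z' [? _] [<-]].
have sideE z l : B.[z] != 0 ->
   (`|(A - cbrt1 l *: B).[z]| < `|(A + cbrt1 l *: B).[z]|) =
   (`|A.[z] / B.[z] - cbrt1 l| < `|A.[z] / B.[z] + cbrt1 l|).
  move=> Bz; rewrite !hornerE -{1 2}(divfK Bz A.[z]) -mulrDl -mulrBl !normrM.
  by rewrite ltr_pM2r// normr_gt0.
have := connected_norm_lt cK (star_preimage_ray j3 KG) Kx Ky.
rewrite !sideE ?BK// wx wy => H.
have := ray_side r0 j3 j3; rewrite eqxx => /H.
have := ray_side r'0 k3 j3; case: eqP => // _ /lt_trans /[apply].
by rewrite ltxx.
Qed.

(** Three rays of the star end at 0. *)
Lemma card_edges_at_zero A B n v :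
    (size A <= n.+1)%N -> (size B <= n.+1)%N ->
    A.[v] = 0 -> B.[v] != 0 -> (A^`() * B - A * B^`()).[v] != 0 -> A`_n != 0 ->
  ([set e | [set connected_component (star_preimage A B) x | x in star_preimage A B] e
     /\ closure e (Some v)] #= `I_3)%card.
Proof.
move=> sA sB Av Bv Wv An.
apply: (@card_branches R A B n v 0 star 3 cbrt1 1) => //; rewrite ?Av ?mul0r//.
- by move=> k _; exact: norm_cbrt1.
- move=> k r _ /andP[r0 r1]; rewrite add0r; apply: star_ray => //.
  by rewrite lt_eqF.
- move=> y [pos _] _; have [k k3 [r r0 ->]] := cube_gt0 pos.
  by exists k => //; exists r => //; rewrite add0r.
- move=> j k r r' x y K j3 k3 /andP[r0 _] /andP[r'0 _] cK KG Kx Ky.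
  by rewrite !add0r; exact: (connected_same_ray cK KG Kx Ky j3 k3).
Qed.

(** Two segments of the star end at a cube root of unity, one on each side of the
    unit circle; the sign of [|A| - |B|] separates them. *)
Lemma card_edges_at_cbrt1 A B n v :
    (size A <= n.+1)%N -> (size B <= n.+1)%N ->
    B.[v] != 0 -> A.[v] ^+ 3 = B.[v] ^+ 3 -> (A^`() * B - A * B^`()).[v] != 0 ->
    A`_n ^+ 3 != B`_n ^+ 3 ->
  ([set e | [set connected_component (star_preimage A B) x | x in star_preimage A B] e
     /\ closure e (Some v)] #= `I_2)%card.
Proof.
move=> sA sB Bv AB3 Wv ABn.
have [l l3 wv] : exists2 l, (l < 3)%N & A.[v] / B.[v] = cbrt1 l.
  by apply: cube_eq1; rewrite expr_div_n AB3 divff// expf_neq0.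
have wr (r : R) k : cbrt1 l + (r%:C)%C * ((-1) ^+ k * cbrt1 l) =
    ((1 + (-1) ^+ k * r)%:C)%C * cbrt1 l.
  by rewrite rmorphD rmorphM rmorphXn rmorphN1 rmorph1; ring.
have pm (r : R) k : (k < 2)%N -> 0 < r < 1 ->
    0 < 1 + (-1) ^+ k * r /\ (1 + (-1) ^+ k * r < 1) = (k == 1%N).
  case: k => [|[|//]] _ /andP[r0 r1]; rewrite ?expr0 ?expr1; split; try lra.
    by apply/negbTE; rewrite -leNgt; lra.
  by rewrite eqxx mulN1r ltrBlDr ltrDl.
apply: (@card_branches R A B n v (cbrt1 l) star 2 (fun k => (-1) ^+ k * cbrt1 l) 1) => //.
- apply: contra ABn => /eqP ->; rewrite exprMn cbrt1_cube mul1r//.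
- by move=> k _; rewrite normrM normrX normrN1 expr1n norm_cbrt1 mulr1.
- move=> k r k2 rr; rewrite wr; have [h1 h2] := pm r k k2 rr.
  apply: star_ray => //.
  move: k2 rr h2; case: k {h1} => [|[|//]] _ /andP[r0 r1] _;
    rewrite ?expr0 ?expr1; apply/eqP; lra.
- move=> y [pos ne1]; have [j j3 [r r0 yE]] := cube_gt0 pos => ylt.
  (* Any other ray is closer to [- cbrt1 l], hence at distance at least 1 from [cbrt1 l]. *)
  have jl : j = l.
    have := ray_side r0 j3 l3; case: eqP => // _; rewrite -yE => lt1.
    have := ler_normB (y + cbrt1 l) (y - cbrt1 l).
    have -> : y + cbrt1 l - (y - cbrt1 l) = 2 * cbrt1 l by ring.
    rewrite normrM norm_cbrt1 mulr1 ger0_norm// => le2.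
    have : (2 : C) < 1 + 1 by apply: (le_lt_trans le2); apply: ltrD => //; exact: lt_trans ylt.
    by rewrite ltxx.
  have r1 : r != 1.
    by apply: contra ne1 => /eqP rE; rewrite yE rE ray_cube expr1n.
  have := r1; rewrite neq_lt => /orP[lt1|gt1].
    exists 1%N => //; exists (1 - r); first by rewrite subr_gt0.
    rewrite wr expr1 yE jl; congr (_ * _); congr (_%:C)%C; ring.
  exists 0%N => //; exists (r - 1); first by rewrite subr_gt0.
  rewrite wr expr0 yE jl; congr (_ * _); congr (_%:C)%C; ring.
- move=> j k r r' x y K j2 k2 rr rr' cK KG Kx Ky; rewrite !wr.
  have [p1 q1] := pm r j j2 rr; have [p2 q2] := pm r' k k2 rr'.
  have ltE z (s : R) : K (Some z) -> 0 < s -> A.[z] / B.[z] = (s%:C)%C * cbrt1 l ->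
      (`|A.[z]| < `|B.[z]|) = (s < 1).
    move=> Kz s0 zE; have Bz : B.[z] != 0 by have [z' [? _] [<-]] := KG _ Kz.
    rewrite -(divfK Bz A.[z]) normrM gtr_pMl ?normr_gt0// zE normrM norm_cbrt1 mulr1.
    by rewrite gtr0_norm ?ltcR// -(ltcR s 1).
  move=> wx wy.
  have KG' : K `<=` Some @` [set z | `|B.[z]| != `|A.[z]|].
    by move=> p /(star_preimage_norm KG)[z zz <-]; exists z => //=; rewrite eq_sym.
  have e1 := ltE _ _ Kx p1 wx; have e2 := ltE _ _ Ky p2 wy.
  have H1 := connected_norm_lt cK KG' Kx Ky; have H2 := connected_norm_lt cK KG' Ky Kx.
  rewrite e1 e2 q1 q2 in H1 H2.
  move: j2 k2 H1 H2; case: j {p1 q1 wx e1} => [|[|//]];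
    case: k {p2 q2 wy e2} => [|[|//]] //= _ _ h1 h2.
    by have := h2 isT.
  by have := h1 isT.
Qed.

End Star.

(** * The j-invariant in a symmetric coordinate *)
Section JInvariant.
Variable R : realType.
Local Notation C := R[i].
Implicit Types (a b u : C) (p q : {poly C}).

(** The [j]-invariant as a function of [a / b], where [a / b] is the Moebius
    coordinate sending the two zeros of [j] to 0 and infinity. It equals 1
    where [a ^ 3 = b ^ 3] and is infinite where [a ^ 3 = - b ^ 3]. *)
Definition jhom a b : P1 R :=
  if a ^+ 3 + b ^+ 3 == 0 then None
  else Some (4 * a ^+ 3 * b ^+ 3 / (a ^+ 3 + b ^+ 3) ^+ 2).

Definition sqrtN3 : C := Complex 0 (Num.sqrt 3).

Lemma sqrtN3_sqr : sqrtN3 ^+ 2 = -3.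
Proof.
have -> : (-3 : C) = ((-3)%:C)%C by rewrite rmorphN rmorph_nat.
rewrite expr2; apply/eqP; rewrite eq_complex /=; apply/andP; split; apply/eqP.
  by rewrite mul0r sub0r -expr2 sqr_sqrtr.
by rewrite mul0r mulr0 addr0.
Qed.

Lemma sqrtN3_neq0 : sqrtN3 != 0.
Proof.
apply/eqP => K0; move/eqP: sqrtN3_sqr.
by rewrite K0 expr0n eq_sym oppr_eq0 pnatr_eq0.
Qed.

Lemma conj_sqrtN3 : (sqrtN3^*)%C = - sqrtN3.
Proof. by apply/eqP; rewrite eq_complex /=; apply/andP; split; apply/eqP; ring. Qed.

(** The zeros of [l ^ 2 - l + 1], at which [j] vanishes. *)
Definition sixth_root : C := (1 + sqrtN3) / 2.
Definition sixth_root' : C := (1 - sqrtN3) / 2.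

Lemma j_of_lambda_oo : j_of_lambda (None : P1 R) = None.
Proof.
rewrite /j_of_lambda /ratmap.
set N : {poly C} := 4%:R *: _; set D : {poly C} := 27%:R *: _.
have sN : size N = 7.
  rewrite /N size_scale ?pnatr_eq0//.
  have s3 : size ('X^2 - 'X + 1 : {poly C}) = 3.
    have s2 : size (- 'X + 1 : {poly C}) = 2.
      by rewrite size_polyDl ?size_polyN ?size_polyX ?size_poly1.
    by rewrite -addrA size_polyDl ?size_polyXn ?s2.
  have := size_exp ('X^2 - 'X + 1 : {poly C}) 3; rewrite s3 /=.
  by case: (size _) => // m /= ->.
have sD : (size D <= 5)%N.
  apply: leq_trans (size_scale_leq _ _) _.
  apply: leq_trans (size_polyMleq _ _) _.
  rewrite size_polyXn /=.
  have := size_exp ('X - 1 : {poly C}) 2.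
  rewrite -polyC1 size_XsubC /=.
  by case: (size _) => // m /= ->.
rewrite sN (maxn_idPl _) ?(leq_trans sD)//=.
by rewrite (nth_default 0) ?eqxx// (leq_trans sD).
Qed.

Lemma j_of_lambda_fin (l : C) : j_of_lambda (Some l) =
  if l ^+ 2 * (l - 1) ^+ 2 == 0 then None
  else Some (4 * (l ^+ 2 - l + 1) ^+ 3 / (27 * (l ^+ 2 * (l - 1) ^+ 2))).
Proof.
have n27 : (27 : C) != 0 by rewrite pnatr_eq0.
by rewrite /j_of_lambda /ratmap !hornerE /= -!mulrA mulf_eq0 (negPf n27) /= -?expr2 !mulrA.
Qed.

(** With [K] the square root of -3 and [a], [b] the arguments of [jhom]: [a + b = K q],
    [a b = - (p ^ 2 - p q + q ^ 2)] and
    [a ^ 3 + b ^ 3 = 3 K p q (p - q)]. *)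
Lemma j_of_lambda_jhom (p q : C) :
  j_of_lambda (if q == 0 then None else Some (p / q)) =
  jhom (sixth_root * q - p) (p - sixth_root' * q).
Proof.
rewrite /jhom; set a := sixth_root * q - p; set b := p - sixth_root' * q.
have K2 := sqrtN3_sqr.
have abE : a ^+ 3 + b ^+ 3 = 3 * sqrtN3 * (p * q * (p - q)).
  by rewrite /a /b /sixth_root /sixth_root'; field: K2.
have abM : a * b = - (p ^+ 2 - p * q + q ^+ 2).
  by rewrite /a /b /sixth_root /sixth_root'; field: K2.
have K0 := sqrtN3_neq0.
have [q0|q0] := eqVneq q 0.
  by rewrite j_of_lambda_oo abE q0 !(mulr0, mul0r) eqxx.
rewrite j_of_lambda_fin.
have -> : (a ^+ 3 + b ^+ 3 == 0) = ((p / q) ^+ 2 * (p / q - 1) ^+ 2 == 0).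
  have -> : p / q - 1 = (p - q) / q by field.
  rewrite abE !mulf_eq0 !invr_eq0 pnatr_eq0 (negPf K0) (negPf q0).
  by case: (p == 0); case: (p - q == 0).
case: ifP => // /negbT; rewrite mulf_eq0 negb_or !expf_eq0 /= => /andP[pq0 pq1].
have -> : 4 * a ^+ 3 * b ^+ 3 = 4 * (a * b) ^+ 3 by ring.
congr Some; rewrite abM abE.
have p0 : p != 0 by apply: contra pq0 => /eqP ->; rewrite mul0r.
have pq : p - q != 0 by apply: contra pq1; rewrite subr_eq0 => /eqP ->; rewrite divff ?subrr.
have -> : (3 * sqrtN3 * (p * q * (p - q))) ^+ 2 = - 27 * (p * q * (p - q)) ^+ 2.
  by ring: K2.
by field; rewrite pq p0 q0.
Qed.

(** [u + 1 / u = 4 / s - 2 >= 2], so the two solutions are real and positive. *)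
Lemma real_fibre_gt0 u (s : R) : 0 < s <= 1 -> 4 * u = (s%:C)%C * (1 + u) ^+ 2 -> 0 < u.
Proof.
case: u => x y /andP[s0 s1]; rewrite !mulrS mulr0n addr0 expr2 => /eqP.
rewrite eq_complex /= => /andP[/eqP re /eqP im].
rewrite ltcE /=.
have y0 : y = 0.
  apply/eqP; apply: contraT => y0.
  have : s * (1 + x) = 2.
    by apply: (mulfI y0); lra.
  move=> sx; have : s * y ^+ 2 = 2 - 2 * x by nra.
  move=> sy; have y2 : 0 < y ^+ 2 by rewrite exprn_even_gt0.
  have x1 : x < 1 by have := mulr_gt0 s0 y2; lra.
  have x0 : 0 < 1 + x by rewrite -(pmulr_rgt0 _ s0) sx.
  have : s * (1 + x) <= 1 + x by rewrite ler_piMl// ltW.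
  lra.
rewrite y0 eqxx /=; subst y.
have re' : 4 * x = s * (1 + x) ^+ 2 by rewrite expr2; lra.
have x0 : 0 <= x.
  have : 0 <= s * (1 + x) ^+ 2 by rewrite mulr_ge0 ?sqr_ge0// ltW.
  lra.
rewrite lt_neqAle x0 andbT; apply: contraTneq s0 => x00.
by move: re'; rewrite -x00 mulr0 addr0 expr1n mulr1 => <-; rewrite ltxx.
Qed.

Lemma jhom_fibre a b (s : R) : 0 < s <= 1 -> jhom a b = Some (s%:C)%C ->
  b != 0 /\ 0 < (a / b) ^+ 3.
Proof.
move=> /andP[s0 s1]; rewrite /jhom; case: ifP => // /negbT ab0 [].
move=> /(congr1 (fun z => z * (a ^+ 3 + b ^+ 3) ^+ 2)); rewrite divfK ?expf_neq0// => E.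
have b0 : b != 0.
  apply/eqP => b0; have s0C : (s%:C)%C != 0 :> C by rewrite eq_complex /= eqxx andbT gt_eqF.
  move: ab0 E; rewrite b0 (expr0n C 3) mulr0 addr0 => a30 /esym/eqP.
  by apply/negP; rewrite mulf_neq0// expf_neq0.
split=> //; apply: (@real_fibre_gt0 _ s); first by rewrite s0.
have b3 : b ^+ 3 != 0 by rewrite expf_neq0.
rewrite expr_div_n.
have -> : 1 + a ^+ 3 / b ^+ 3 = (a ^+ 3 + b ^+ 3) / b ^+ 3 by field.
by rewrite [in RHS]expr_div_n [RHS]mulrA -E; field.
Qed.

Lemma jhom_open a b :
  (exists2 s : R, 0 < s < 1 & jhom a b = Some (s%:C)%C) <-> b != 0 /\ star (a / b).
Proof.
split=> [[s /andP[s0 s1] E]|[b0 [pos ne1]]].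
  have [b0 pos] : b != 0 /\ 0 < (a / b) ^+ 3 by apply: (@jhom_fibre a b s); rewrite // s0 ltW.
  split=> //; split=> //; apply/eqP => u1.
  have ab : a ^+ 3 = b ^+ 3 by rewrite -[a](divfK b0) exprMn u1 mul1r.
  move: E; rewrite /jhom ab; case: ifP => // _ [] E.
  have b3 : b ^+ 3 != 0 by rewrite expf_neq0.
  have : (s%:C)%C = 1 :> C.
    by rewrite -E -mulr2n -[X in X ^+ 2]mulr_natl; field; rewrite b0.
  by move=> /(congr1 (@complex.Re R)) /= sE; rewrite sE ltxx in s1.
have b3 : b ^+ 3 != 0 by rewrite expf_neq0.
have uE : (((complex.Re ((a / b) ^+ 3))%:C)%C : C) = (a / b) ^+ 3 by rewrite RRe_real ?gtr0_real.
move: (complex.Re _) uE => x uE.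
have x0 : 0 < x by rewrite -ltcR uE.
have x1 : x != 1 by apply: contra ne1 => /eqP x1; rewrite -uE x1.
have aE : a ^+ 3 = (x%:C)%C * b ^+ 3 by rewrite uE expr_div_n divfK.
have x10 : ((1 + x)%:C)%C != 0 :> C by rewrite eq_complex /= eqxx andbT gt_eqF// addr_gt0.
have abE : a ^+ 3 + b ^+ 3 = ((1 + x)%:C)%C * b ^+ 3 by rewrite aE rmorphD rmorph1; ring.
exists (4 * x / (1 + x) ^+ 2).
  have xx : 0 < (1 + x) ^+ 2 by rewrite exprn_gt0// addr_gt0.
  apply/andP; split; first by apply: divr_gt0 => //; exact: mulr_gt0.
  rewrite ltr_pdivrMr// mul1r.
  have : 0 < (x - 1) ^+ 2 by rewrite exprn_even_gt0//= subr_eq0.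
  by rewrite !expr2; lra.
rewrite /jhom abE mulf_eq0 (negPf x10) (negPf b3) /= aE; congr Some.
rewrite rmorphM fmorphV rmorphXn rmorphM /= rmorph_nat.
rewrite rmorphD rmorph1 in x10 *.
move: x10; set X : C := (x%:C)%C => x10.
by field; rewrite x10 b0.
Qed.

Lemma jhom_closed a b (s : R) : 0 <= s <= 1 -> jhom a b = Some (s%:C)%C ->
  a ^+ 3 + b ^+ 3 != 0 /\ 0 <= a ^+ 3 * (b ^+ 3)^*%C.
Proof.
move=> /andP[s0 s1] E; split; first by move: E; rewrite /jhom; case: eqP.
move: s0; rewrite le_eqVlt => /predU1P[s0|s0].
  move: E; rewrite /jhom; case: ifP => // /negbT ab0 [] /eqP.
  rewrite -s0 mulf_eq0 invr_eq0 [(_ + _) ^+ 2 == 0]expf_eq0 (negPf ab0) orbF.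
  rewrite -mulrA mulf_eq0 pnatr_eq0 /=.
  by rewrite mulf_eq0 => /orP[] /eqP ->; rewrite ?conjc0 ?mulr0 ?mul0r.
have [b0 pos] : b != 0 /\ 0 < (a / b) ^+ 3 by apply: (@jhom_fibre a b s); rewrite // s0.
have -> : a ^+ 3 = (a / b) ^+ 3 * b ^+ 3 by rewrite -exprMn divfK.
by rewrite -mulrA mulr_ge0 ?(ltW pos)// mulcJ_ge0.
Qed.

Lemma jhom_eq0 a b : jhom a b = Some 0 -> (a == 0) != (b == 0).
Proof.
rewrite /jhom; case: ifP => // /negbT ab0 [] /eqP.
rewrite mulf_eq0 invr_eq0 [(_ + _) ^+ 2 == 0]expf_eq0 (negPf ab0) orbF -mulrA mulf_eq0 pnatr_eq0 /=.
rewrite mulf_eq0 !expf_eq0 /=; case: eqVneq => [a0|_]; case: eqVneq => [b0|_] //.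
by rewrite a0 b0 expr0n addr0 eqxx in ab0.
Qed.

Lemma jhom_eq1 a b : jhom a b = Some 1 -> b != 0 /\ a ^+ 3 = b ^+ 3.
Proof.
rewrite /jhom; case: ifP => // /negbT ab0 [].
move=> /(congr1 (fun z => z * (a ^+ 3 + b ^+ 3) ^+ 2)); rewrite divfK ?expf_neq0// => E.
have ab : a ^+ 3 = b ^+ 3.
  have : (a ^+ 3 - b ^+ 3) ^+ 2 = 0.
    have -> : (a ^+ 3 - b ^+ 3) ^+ 2 = (a ^+ 3 + b ^+ 3) ^+ 2 - 4 * a ^+ 3 * b ^+ 3 by ring.
    by rewrite E mul1r subrr.
  by move/eqP; rewrite expf_eq0 /= subr_eq0 => /eqP.
split=> //; apply: contra ab0 => /eqP b0.
by rewrite ab b0 expr0n addr0.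
Qed.

End JInvariant.

(** * Critical points of the j-map *)
Section DerivativeOfQuotient.
Variable K : numClosedFieldType.
Implicit Types (p N D : {poly K}) (x : K).

Lemma is_derive_horner p x : is_derive x (1 : K) (horner p : K -> K) p^`().[x].
Proof.
elim/poly_ind: p => [|p c ih].
  have -> : horner 0 = cst 0 :> (K -> K) by apply/funext => y; rewrite horner0.
  by rewrite deriv0 horner0; exact: is_derive_cst.
have -> : horner (p * 'X + c%:P) = (horner p : K -> K) * id + cst c.
  by apply/funext => y; rewrite !hornerE.
apply: is_derive_eq.
rewrite /GRing.scale /= derivD derivM derivX derivC !hornerE /=. by ring.
Qed.

(** Converts a vanishing analytic derivative into a polynomial identity at the point. *)
Lemma is_derive_quotient_eq0 N D x : D.[x] != 0 ->
  is_derive x (1 : K) (fun y : K => N.[y] / D.[y] : K) (0 : K) ->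
  N^`().[x] * D.[x] = N.[x] * D^`().[x].
Proof.
move=> Dx dq.
have dD := is_derive_horner D x; have dN := is_derive_horner N x.
have dV : is_derive x (1 : K) (fun y : K => (D.[y])^-1 : K) (- D.[x] ^- 2 *: D^`().[x]).
  apply: DeriveDef; first by apply: derivableV => //; case: dD.
  by case: dD => d1 d2; rewrite deriveV// d2.
have [_] := is_deriveM dN dV.
have -> : (horner N : K -> K) * (fun y => (D.[y])^-1) = (fun y => N.[y] / D.[y]) by [].
case: dq => _ ->; rewrite /GRing.scale /= => /eqP E.
apply/eqP; rewrite -subr_eq0; apply/eqP.
have -> : N^`().[x] * D.[x] - N.[x] * D^`().[x] =
  D.[x] ^+ 2 * (N.[x] * (- D.[x] ^- 2 * D^`().[x]) + (D.[x])^-1 * N^`().[x]) by field.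
by rewrite -(eqP E) mulr0.
Qed.

(** The numerator of the derivative of [j]: away from the poles of [j], it
    vanishes only at the preimages of 0 and 1 and at the zeros of the Wronskian. *)
Lemma deriv_j_numerator (A B : {poly K}) :
  let N := 4%:P * A ^+ 3 * B ^+ 3 in let D := (A ^+ 3 + B ^+ 3) ^+ 2 in
  N^`() * D - N * D^`() = 12%:P * (A ^+ 3 + B ^+ 3) * (B ^+ 3 - A ^+ 3) *
     (A ^+ 2 * B ^+ 2) * (A^`() * B - A * B^`()).
Proof.
move=> N D; rewrite /N /D !(derivM, derivC, derivD, deriv_exp) /= !(polyCD, rmorph_nat).
by ring.
Qed.

End DerivativeOfQuotient.

(** * A criterion for a dessin to be simple *)
Section Criterion.
Variables (R : realType) (n : nat) (c : crtc R n).
Local Notation C := R[i].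

Let p := y1 c - y3 c.
Let q := y2 c - y3 c.

(** [Apoly / Bpoly] is [lambda] followed by the Moebius coordinate in which [j] is
    given by [jhom]. *)
Definition Apoly : {poly C} := sixth_root R *: q - p.
Definition Bpoly : {poly C} := p - sixth_root' R *: q.

Let szp : (size p <= n.+1)%N.
Proof.
rewrite -(crtc_degree c) (leq_trans (size_polyD _ _))// size_polyN geq_max.
by rewrite leq_maxl !leq_max leqnn !orbT.
Qed.

Let szq : (size q <= n.+1)%N.
Proof.
rewrite -(crtc_degree c) (leq_trans (size_polyD _ _))// size_polyN geq_max.
by rewrite !leq_max !leqnn !orbT.
Qed.

Lemma size_Apoly : (size Apoly <= n.+1)%N.
Proof.
rewrite (leq_trans (size_polyD _ _))// size_polyN geq_max szp andbT.
exact: leq_trans (size_scale_leq _ _) szq.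
Qed.

Lemma size_Bpoly : (size Bpoly <= n.+1)%N.
Proof.
rewrite (leq_trans (size_polyD _ _))// size_polyN geq_max szp /=.
exact: leq_trans (size_scale_leq _ _) szq.
Qed.

Let pq_oo : (p`_n == 0) && (q`_n == 0) = false.
Proof.
apply/negP => /andP[]; rewrite !coefB !subr_eq0 => /eqP e1 /eqP e2.
by apply: (crtc_no_triple_oo (c := c)); rewrite e1 e2.
Qed.

Lemma jmap_Some z : jmap c (Some z) = jhom Apoly.[z] Bpoly.[z].
Proof. by rewrite /jmap /lambda /ratmap /= j_of_lambda_jhom !hornerE. Qed.

Lemma jmap_None : jmap c None = jhom Apoly`_n Bpoly`_n.
Proof.
rewrite /jmap /lambda /ratmap /= -/p -/q.
have -> : (maxn (size p) (size q)).-1 = n.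
  suff -> : maxn (size p) (size q) = n.+1 by [].
  apply/eqP; rewrite eqn_leq geq_max szp szq /= ltnNge geq_max.
  by apply: contraFN pq_oo => /andP[sp sq]; rewrite !nth_default ?eqxx.
by rewrite j_of_lambda_jhom !(coefB, coefZ).
Qed.

Let AB_oo : ~ (Apoly`_n = 0 /\ Bpoly`_n = 0).
Proof.
rewrite /Apoly /Bpoly [(_ - p)`_n]coefB [(p - _)`_n]coefB !coefZ => -[a0 b0].
move/negP: pq_oo; apply.
have q0 : q`_n = 0.
  apply: (mulfI (sqrtN3_neq0 R)); rewrite mulr0.
  have -> : sqrtN3 R * q`_n = (sixth_root R * q`_n - p`_n) + (p`_n - sixth_root' R * q`_n).
    by rewrite /sixth_root /sixth_root'; field.
  by rewrite a0 b0 addr0.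
by move: a0; rewrite q0 mulr0 sub0r => /eqP; rewrite oppr_eq0 => ->; rewrite eqxx.
Qed.

Let W := Apoly^`() * Bpoly - Apoly * Bpoly^`().

(* The criterion for simplicity: the dessin avoids infinity and the
   finite critical points of lambda, which are the zeros of the Wronskian of A and B. *)
Hypothesis jmap_oo : forall s : R, 0 <= s <= 1 -> jmap c None <> Some (s%:C)%C.
Hypothesis jmap_reg : forall z (s : R), 0 <= s <= 1 ->
  jmap c (Some z) = Some (s%:C)%C -> W.[z] != 0.

Lemma monochrome_omega : monochrome (omega c) = set0.
Proof.
apply/seteqP; split => // -[z|] [[_ ram] [s /=]]; last first.
  rewrite in_itv /= => /andP[s0 s1] /esym; apply: jmap_oo.
  by rewrite !ltW.
rewrite in_itv /= => s01 /esym jz.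
have s01' : 0 <= s <= 1 by case/andP: s01 => s0 s1; rewrite !ltW.
have Wz := jmap_reg s01' jz.
move: (jz); rewrite jmap_Some => jz'.
have [B0 [pos ne1]] : Bpoly.[z] != 0 /\ star (Apoly.[z] / Bpoly.[z]) by apply/jhom_open; exists s.
have [ab0 _] := jhom_closed s01' jz'.
(* Translation by [z], the local coordinate at [z]. *)
pose sh (P : {poly C}) := P \Po ('X + z%:P).
have shE P h : (sh P).[h] = P.[z + h] by rewrite horner_comp !hornerE addrC.
pose N := sh (4%:P * Apoly ^+ 3 * Bpoly ^+ 3).
pose D := sh ((Apoly ^+ 3 + Bpoly ^+ 3) ^+ 2).
have NE h : N.[h] = 4 * Apoly.[z + h] ^+ 3 * Bpoly.[z + h] ^+ 3.
  by rewrite shE hornerM hornerM hornerC !horner_exp.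
have DE h : D.[h] = (Apoly.[z + h] ^+ 3 + Bpoly.[z + h] ^+ 3) ^+ 2.
  by rewrite shE horner_exp hornerD !horner_exp.
have fE : (fun h : C => odflt 0 (jmap c (chart (Some z) h)) : C) =
          (fun h : C => N.[h] / D.[h]).
  (* At a pole of [j] both sides are 0, by the conventions for [odflt] and for division by 0. *)
  apply/funext => h; rewrite /chart jmap_Some /jhom NE DE.
  by case: eqP => [->|_] //=; rewrite expr0n invr0 mulr0.
rewrite fE in ram.
have D0 : D.[0] != 0 by rewrite DE addr0 expf_neq0.
have dsh P : (sh P)^`().[0] = P^`().[z].
  by rewrite /sh deriv_comp derivD derivX derivC addr0 mulr1 horner_comp !hornerE.
have E := is_derive_quotient_eq0 D0 ram; rewrite !dsh in E.
have jet := congr1 (horner^~ z) (deriv_j_numerator Apoly Bpoly).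
have A0 : Apoly.[z] != 0 by apply: contraTneq pos => ->; rewrite mul0r expr0n ltxx.
have AB : Bpoly.[z] ^+ 3 - Apoly.[z] ^+ 3 != 0.
  rewrite subr_eq0 eq_sym; apply: contra ne1 => /eqP ABz.
  by rewrite expr_div_n ABz divff// expf_neq0.
suff : (Bpoly.[z] ^+ 3 - Apoly.[z] ^+ 3) * W.[z] = 0.
  by apply/eqP; rewrite mulf_neq0.
have unit : 12 * (Apoly.[z] ^+ 3 + Bpoly.[z] ^+ 3) * (Apoly.[z] ^+ 2 * Bpoly.[z] ^+ 2) != 0 :> C.
  by rewrite !mulf_neq0 ?expf_neq0 ?pnatr_eq0.
apply: (mulfI unit); rewrite mulr0.
move: jet; rewrite /= hornerD hornerN.
rewrite [((_ * _)^`() * _).[z]]hornerM [(_ * _ * (_ ^+ 2)^`()).[z]]hornerM.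
have shz P : P.[z] = (sh P).[0] by rewrite shE addr0.
rewrite (shz (4%:P * Apoly ^+ 3 * Bpoly ^+ 3)) (shz ((Apoly ^+ 3 + Bpoly ^+ 3) ^+ 2)).
rewrite -/N -/D E subrr => jet.
rewrite [RHS]jet.
rewrite hornerM -/W [(12%:P * _ * _ * _).[z]]hornerM [(12%:P * _ * _).[z]]hornerM.
rewrite [(12%:P * _).[z]]hornerM hornerC [(Apoly ^+ 3 + _).[z]]hornerD.
rewrite [(Bpoly ^+ 3 - _).[z]]hornerD [(- Apoly ^+ 3).[z]]hornerN !(hornerM (_ ^+ 2)) !horner_exp.
ring.
Qed.

(** There being no monochrome vertex, the edges are the components of the preimage
    of [j^{-1}(]0, 1[)], which is the star. *)
Lemma edges_omega : edges (omega c) =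
  [set connected_component (quotient_preimage Apoly Bpoly (@star R)) x
    | x in quotient_preimage Apoly Bpoly (@star R)].
Proof.
suff GE : graph (omega c) `\` (black (omega c) `|` white (omega c) `|` monochrome (omega c)) =
    quotient_preimage Apoly Bpoly (@star R) by rewrite /edges GE.
rewrite monochrome_omega setU0; apply/seteqP; split => [v [[s /=]]|_ [z zG <-]].
  rewrite in_itv /= => s01 js nv.
  case: v js nv => [z|] js nv; last by case: (jmap_oo s01).
  exists z => //; apply/jhom_open; exists s; last by rewrite -jmap_Some.
  case/andP: s01 => s0 s1; rewrite !lt_neqAle s0 s1 !andbT.
  apply/andP; split; apply/eqP => e; apply: nv; [left|right]; exists s => //=.
have [s s01 js] := (jhom_open _ _).2 zG; rewrite -jmap_Some in js.
case/andP: s01 => s0 s1.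
split; first by exists s => //=; rewrite in_itv /= !ltW.
by case=> -[t /= ->]; rewrite js => -[] e; [rewrite e ltxx in s0|rewrite e ltxx in s1].
Qed.

Lemma simple_omega : simple_dessin (omega c).
Proof.
have le01 : 0 <= (0 : R) <= 1 by rewrite lexx ler01.
have le11 : 0 <= (1 : R) <= 1 by rewrite lexx ler01.
have An0 : Apoly`_n != 0.
  apply/eqP => a0; apply: (jmap_oo le01); rewrite jmap_None /jhom a0 expr0n /= add0r.
  rewrite expf_eq0 /=; case: eqP => [b0|_]; first by case: AB_oo.
  by rewrite mulr0 !mul0r.
have Bn0 : Bpoly`_n != 0.
  apply/eqP => b0; apply: (jmap_oo le01); rewrite jmap_None /jhom b0 expr0n /= addr0.
  rewrite expf_eq0 /= (negPf An0); congr Some.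
  by rewrite mulr0 !mul0r.
have ABn : Apoly`_n ^+ 3 != Bpoly`_n ^+ 3.
  apply/eqP => ab; apply: (jmap_oo le11); rewrite jmap_None /jhom ab.
  rewrite -mulr2n mulrn_eq0 expf_eq0 /= (negPf Bn0); congr Some.
  by rewrite rmorph1 -[X in X ^+ 2]mulr_natl; field; rewrite Bn0.
split; last exact: monochrome_omega.
- move=> [z|] [s /= s0 js]; last by case: (jmap_oo le01); rewrite -js s0.
  rewrite s0 in js; have Wz := jmap_reg le01 (esym js).
  rewrite jmap_Some in js; rewrite /has_degree edges_omega.
  have := jhom_eq0 (esym js).
  have [A0|A0] := eqVneq Apoly.[z] 0; have [B0|B0] := eqVneq Bpoly.[z] 0 => // _.
    by apply: (@card_edges_at_zero R _ _ n) => //; [exact: size_Apoly|exact: size_Bpoly].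
  (* A zero of [Bpoly] becomes a zero of the numerator after exchanging [Apoly] and [Bpoly]. *)
  rewrite (star_preimage_sym Apoly Bpoly).
  apply: (@card_edges_at_zero R _ _ n) => //; [exact: size_Bpoly|exact: size_Apoly|].
  have -> : Bpoly^`() * Apoly - Bpoly * Apoly^`() = - W by rewrite /W; ring.
  by rewrite hornerN oppr_eq0.
- move=> [z|] [s /= s1 js]; last by case: (jmap_oo le11); rewrite -js s1.
  rewrite s1 in js; have Wz := jmap_reg le11 (esym js).
  rewrite jmap_Some in js; rewrite /has_degree edges_omega.
  have [B0 AB3] := jhom_eq1 (esym js).
  by apply: (@card_edges_at_cbrt1 R _ _ n) => //; [exact: size_Apoly|exact: size_Bpoly].
Qed.

End Criterion.

(** * Wronskians *)
Section Wronskian.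
Variable K : numClosedFieldType.
Implicit Types (p q : {poly K}).

Lemma deriv_eq0_size p : p^`() = 0 -> (size p <= 1)%N.
Proof.
move=> p0; apply/leq_sizeP => -[//|i] _; apply/eqP.
by have /eqP := congr1 (fun r : {poly K} => r`_i) p0; rewrite coef_deriv coef0 mulrn_eq0.
Qed.

Lemma dvdp_deriv_size p : p %| p^`() -> (size p <= 1)%N.
Proof.
move=> pp; have [->|p0] := eqVneq p 0; first by rewrite size_poly0.
apply: deriv_eq0_size; apply/eqP; apply: contraT => dp0.
by have := dvdp_leq dp0 pp; rewrite leqNgt lt_size_deriv.
Qed.

(** If [q' p = q p'] then, [p] and [q] being coprime, each of them divides its own
    derivative, hence is constant. *)
Lemma wronskian_neq0 p q : (forall x, ~ (p.[x] = 0 /\ q.[x] = 0)) ->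
  (1 < maxn (size p) (size q))%N -> q^`() * p - q * p^`() != 0.
Proof.
move=> noroot; apply: contraL; rewrite subr_eq0 => /eqP E.
have cop : coprimep p q.
  apply: contraT => /closed_rootP[x]; rewrite root_gcd => /andP[/eqP px /eqP qx].
  by case: (noroot x).
rewrite -leqNgt geq_max; apply/andP; split; apply: dvdp_deriv_size.
  by rewrite -(Gauss_dvdpr _ cop) -E dvdp_mull.
have cop' : coprimep q p by rewrite coprimep_sym.
by rewrite -(Gauss_dvdpl _ cop') E dvdp_mulr.
Qed.

(** The coordinate change [lambda |-> (b - lambda - t) / (lambda + t - b')]
    multiplies the Wronskian by the constant [b - b']; in particular the critical
    points do not depend on [t]. *)
Lemma wronskian_mobius (b b' t : K) p q :
  let a := b *: q - (p + t *: q) in let d := p + t *: q - b' *: q in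
  a^`() * d - a * d^`() = (b - b') *: (q^`() * p - q * p^`()).
Proof.
move=> a d; rewrite /a /d !(derivD, derivN, derivZ) -!mul_polyC polyCB; ring.
Qed.

Lemma small_nonroot p (N : nat) : p != 0 ->
  exists2 k : nat, (N <= k)%N & ~~ root p (k.+1%:R^-1).
Proof.
move=> p0; apply: contrapT => none.
pose s := [seq (k.+1%:R^-1 : K) | k <- iota N (size p)].
have us : uniq s.
  rewrite map_inj_uniq ?iota_uniq// => i j /invr_inj /eqP.
  by rewrite eqr_nat eqSS => /eqP.
have := max_poly_roots p0 _ us; rewrite size_map size_iota ltnn => /(_ _)/negP; apply => //.
apply/allP => _ /mapP[k + ->]; rewrite mem_iota => /andP[Nk _].
by apply: contrapT => /negP nr; apply: none; exists k.
Qed.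

End Wronskian.

(** * Shifting lambda *)
Section Shift.
Variables (R : realType) (n : nat).
Local Notation C := R[i].
Implicit Types (c : crtc R n) (t s : C).

Section Def.
Variables (c : crtc R n) (t : C).

Let y1t := y1 c + t *: (y2 c - y3 c).

Let shift_no_triple : ~ exists x : C, y1t.[x] = (y2 c).[x] /\ (y2 c).[x] = (y3 c).[x].
Proof.
case=> x []; rewrite /y1t !hornerE => e1 e2; apply: (crtc_no_triple (c := c)).
by exists x; move: e1; rewrite e2 subrr mulr0 addr0.
Qed.

Let shift_no_triple_oo : ~ (y1t`_n = (y2 c)`_n /\ (y2 c)`_n = (y3 c)`_n).
Proof.
case; rewrite /y1t coefD coefZ coefB => e1 e2; apply: (crtc_no_triple_oo (c := c)).
by move: e1; rewrite e2 subrr mulr0 addr0.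
Qed.

Let shift_degree : maxn (size y1t) (maxn (size (y2 c)) (size (y3 c))) = n.+1.
Proof.
have := crtc_degree c => dc.
have s1 : (size (y1 c) <= n.+1)%N by rewrite -dc leq_maxl.
have s2 : (size (y2 c) <= n.+1)%N by rewrite -dc !leq_max leqnn orbT.
have s3 : (size (y3 c) <= n.+1)%N by rewrite -dc !leq_max leqnn !orbT.
apply/eqP; rewrite eqn_leq !geq_max s2 s3 !andbT; apply/andP; split.
  rewrite (leq_trans (size_polyD _ _))// geq_max s1 (leq_trans (size_scale_leq _ _))//.
  by rewrite (leq_trans (size_polyD _ _))// geq_max s2 size_polyN s3.
rewrite ltnNge !geq_max; apply/negP => /and3P[h1 h2 h3].
by apply: shift_no_triple_oo; rewrite !nth_default.
Qed.

(** The perturbation that replaces [lambda] by [lambda + t]. *)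
Definition shift : crtc R n := Crtc shift_degree shift_no_triple shift_no_triple_oo.

End Def.

Definition shift_direction c : 'M[C]_(3, n.+1) :=
  \matrix_(i, j) if i == ord0 then (y2 c - y3 c)`_j else 0.

Lemma crtc_coef_shift c t :
  crtc_coef (shift c t) = crtc_coef c + t *: shift_direction c.
Proof.
apply/matrixP => i j; rewrite !mxE; case: i => -[|[|[|//]]] i3 /=.
- by rewrite coefD coefZ.
- by rewrite mulr0 addr0.
- by rewrite mulr0 addr0.
Qed.

Lemma nbhs_line (M D : 'M[C]_(3, n.+1)) (O : set 'M[C]_(3, n.+1)) : nbhs M O ->
  exists2 d : C, 0 < d & forall t, `|t| < d -> O (M + t *: D).
Proof.
move=> /(@nbhs_ballP C _ M O)[e /= e0 eO].
pose b := \sum_i \sum_j `|D i j| + 1.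
have b1 : 0 <= \sum_i \sum_j `|D i j| by apply: sumr_ge0 => i _; apply: sumr_ge0.
have b0 : 0 < b by rewrite ltr_wpDl.
exists (e / b); first by rewrite divr_gt0.
move=> t; rewrite ltr_pdivlMr// => tb; apply: eO; split=> // i j.
rewrite -ball_normE /= !mxE opprD addNKr normrN normrM.
apply: le_lt_trans tb; rewrite ler_wpM2l//.
have -> : b = `|D i j| + (\sum_(j' | j' != j) `|D i j'| + \sum_(i' | i' != i) \sum_j `|D i' j| + 1).
  by rewrite /b (bigD1 i)//= (bigD1 j)//= !addrA.
rewrite lerDl addr_ge0// addr_ge0// sumr_ge0// => i' _; exact: sumr_ge0.
Qed.

(** At a real [t] this is [2 i] times the imaginary part of
    [(a - t) ^ 3 * conj (m + t) ^ 3], which is positively proportional to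
    [w ^ 3] for the symmetric coordinate [w = (a - t) / (m + t)] of [s + t]. So
    it vanishes whenever [j (s + t)] is real and between 0 and 1. *)
Definition theta_poly s : {poly C} :=
  let a := sixth_root R - s in let m := s - sixth_root' R in
  (a%:P - 'X) ^+ 3 * ('X + (m^*%C)%:P) ^+ 3 -
  ((a^*%C)%:P - 'X) ^+ 3 * ('X + m%:P) ^+ 3.

Lemma horner_theta_poly s x :
  let a := sixth_root R - s in let m := s - sixth_root' R in
  (theta_poly s).[x] =
    (a - x) ^+ 3 * (x + m^*%C) ^+ 3 - (a^*%C - x) ^+ 3 * (x + m) ^+ 3.
Proof.
move=> a m; rewrite /theta_poly -/a -/m.
by rewrite !(hornerD, hornerN, hornerM, horner_exp, hornerX, hornerC).
Qed.

Lemma sixth_rootB : sixth_root R - sixth_root' R = sqrtN3 R.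
Proof. by rewrite /sixth_root /sixth_root'; field. Qed.

(** Evaluation at [a] and at [- m] shows that if the polynomial vanished then [a]
    and [m] would be real, whereas [a + m] is a square root of -3. *)
Lemma theta_poly_neq0 s : theta_poly s != 0.
Proof.
apply/eqP => Q0; have Qx x : (theta_poly s).[x] = 0 by rewrite Q0 horner0.
pose a := sixth_root R - s; pose m := s - sixth_root' R.
 have am : a + m = sqrtN3 R by rewrite -sixth_rootB /a /m; ring.
have am0 : a + m != 0 by rewrite am (sqrtN3_neq0 R).
have ca : (a^*)%C = a.
  have := Qx a; rewrite horner_theta_poly -/a -/m subrr expr0n /= mul0r sub0r => /eqP.
  by rewrite oppr_eq0 mulf_eq0 !expf_eq0 /= (negPf am0) orbF subr_eq0 => /eqP.
have cm : (m^*)%C = m.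
  have := Qx (- m); rewrite horner_theta_poly -/a -/m opprK [- m + m]addrC.
  rewrite subrr expr0n /= mulr0 subr0 => /eqP.
  by rewrite mulf_eq0 !expf_eq0 /= (negPf am0) /= addrC subr_eq0 => /eqP.
have : ((sqrtN3 R)^*)%C = sqrtN3 R by rewrite -am rmorphD /= ca cm.
rewrite conj_sqrtN3 => /eqP; rewrite eq_sym -subr_eq0 opprK -mulr2n mulrn_eq0 /=.
by rewrite (negPf (sqrtN3_neq0 R)).
Qed.

(** [p / q] stands for a value of [lambda]; it is infinite when [q = 0], and then
    [j] is infinite after the shift too. *)
Lemma jhom_shift (p q : C) (t : R) (r : R) :
  (theta_poly (p / q)).[(t%:C)%C] != 0 -> 0 <= r <= 1 ->
  jhom (sixth_root R * q - (p + (t%:C)%C * q)) (p + (t%:C)%C * q - sixth_root' R * q)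
    <> Some (r%:C)%C.
Proof.
set T : C := (t%:C)%C; move=> Q0 r01 /(jhom_closed r01).
have [->|q0] := eqVneq q 0.
  rewrite !mulr0 !addr0 sub0r subr0 => -[+ _].
  by rewrite exprNn -[(-1) ^+ 3]signr_odd expr1 mulN1r addNr eqxx.
case=> _; set s := p / q in Q0 *.
have -> : sixth_root R * q - (p + T * q) = (sixth_root R - s - T) * q.
  by rewrite /s; field.
have -> : p + T * q - sixth_root' R * q = (T + (s - sixth_root' R)) * q.
  by rewrite /s; field.
set a := _ - s; set m := s - _ => ge0.
have cT : (T^*)%C = T by rewrite /T conjc_real.
have cge := ger0_Im ge0.
have cM (u v : C) : ((u * v)^*)%C = (u^*)%C * (v^*)%C by exact: rmorphM.
have cB (u v : C) : ((u - v)^*)%C = (u^*)%C - (v^*)%C by exact: rmorphB.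
have cD (u v : C) : ((u + v)^*)%C = (u^*)%C + (v^*)%C by exact: rmorphD.
have cX (u : C) : ((u ^+ 3)^*)%C = (u^*)%C ^+ 3 by exact: rmorphXn.
apply: (negP Q0); rewrite horner_theta_poly -/a -/m subr_eq0.
have q3 : (q * (q^*)%C) ^+ 3 != 0 by rewrite expf_neq0// mulf_neq0// conjc_eq0.
apply/eqP; apply: (mulIf q3).
pose z := ((a - T) * q) ^+ 3 * ((((T + m) * q) ^+ 3)^*)%C.
have zc : (z^*)%C = z.
  by move: cge; rewrite -/z; case: (z) => x y /= ->; rewrite oppr0.
have -> : (a - T) ^+ 3 * (T + (m^*)%C) ^+ 3 * (q * (q^*)%C) ^+ 3 = z.
  by rewrite /z cX cM cD cT; ring.
rewrite -zc /z cM !cX conjcK cM cB cT; ring.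
Qed.

(** The translates by [t] of the finite critical values of [lambda] and of its
    value at infinity avoid the dessin for all but finitely many [t]. *)
Lemma shift_simple c : (1 <= n)%N -> exists2 P : {poly C}, P != 0 &
  forall t : R, ~~ root P (t%:C)%C -> simple_dessin (omega (shift c (t%:C)%C)).
Proof.
move=> n1; pose p := y1 c - y3 c; pose q := y2 c - y3 c.
pose V := q^`() * p - q * p^`().
have V0 : V != 0.
  apply: wronskian_neq0.
    move=> x [px qx]; apply: (crtc_no_triple (c := c)); exists x.
    move: px qx; rewrite /p /q !hornerE => /eqP; rewrite subr_eq0 => /eqP ->.
    by move=> /eqP; rewrite subr_eq0 => /eqP ->.
  apply: (leq_trans (n := n.+1)); first by [].
  rewrite ltnNge geq_max; apply/negP => /andP[sp sq].
  apply: (crtc_no_triple_oo (c := c)).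
  have : p`_n = 0 /\ q`_n = 0 by rewrite !nth_default.
  rewrite /p /q !coefB => -[/eqP + /eqP]; rewrite !subr_eq0 => /eqP -> /eqP ->.
  by [].
have [rs Vrs] := closed_field_poly_normal V.
(* Infinite values of [lambda] contribute the harmless entry 0 to this list. *)
pose S := p`_n / q`_n :: [seq p.[x] / q.[x] | x <- rs].
exists (\prod_(s <- S) theta_poly s).
  by rewrite prodf_seq_neq0; apply/allP => s _; exact: theta_poly_neq0.
move=> t; rewrite /root horner_prod prodf_seq_neq0 => /allP good.
pose T : C := (t%:C)%C.
have py : y1 (shift c T) - y3 (shift c T) = p + T *: q.
  by rewrite /= /p addrAC.
have qy : y2 (shift c T) - y3 (shift c T) = q by [].
have AE : Apoly (shift c T) = sixth_root R *: q - (p + T *: q) by rewrite /Apoly py qy.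
have BE : Bpoly (shift c T) = p + T *: q - sixth_root' R *: q by rewrite /Bpoly py qy.
apply: simple_omega => [r r01|z r r01].
  rewrite jmap_None AE BE.
  rewrite [(_ - (p + T *: q))`_n]coefB [(p + T *: q - _)`_n]coefB [(p + _)`_n]coefD !coefZ.
  by apply: jhom_shift => //; apply: good; rewrite mem_head.
rewrite jmap_Some AE BE => js; apply/negP => /eqP Wz.
have Vz : V.[z] = 0.
  apply: (mulfI (sqrtN3_neq0 R)); rewrite mulr0 -Wz -sixth_rootB -hornerZ.
  by rewrite -(wronskian_mobius _ _ T).
have zrs : z \in rs.
  by move: Vz => /eqP; rewrite -/(root V z) Vrs rootZ ?lead_coef_eq0// root_prod_XsubC.
have evA (f g : {poly C}) u : (u *: g - (f + T *: g)).[z] = u * g.[z] - (f.[z] + T * g.[z]).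
  by rewrite !hornerE.
have evB (f g : {poly C}) u : (f + T *: g - u *: g).[z] = f.[z] + T * g.[z] - u * g.[z].
  by rewrite !hornerE.
move: js; rewrite evA evB; apply: jhom_shift => //; apply: (implyP (good _ _)) => //.
by rewrite inE; apply/orP; right; apply/mapP; exists z.
Qed.

End Shift.

(** * Density of simple dessins *)

Theorem corollary1 (R : realType) (n : nat) (hn : (1 <= n)%N) :
  forall D : dessins R n,
    closure [set D' : dessins R n | simple_dessin (set_val D')] D.
Proof.
move=> D U; rewrite nbhsE => -[V [oV VD] VU].
have [c _ cD] : range (@omega R n) (set_val D) by exact: set_valP.
have DE : D = to_dessins c by apply: val_inj; rewrite /= cD.
have oV' : open (@to_dessins R n @^-1` V) by [].
have [O oO OE] : exists2 O : set 'M[R[i]]_(3, n.+1), open O &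
    @crtc_coef R n @^-1` O = @to_dessins R n @^-1` V by exact: oV'.
have Oc : O (crtc_coef c).
  have : (@crtc_coef R n @^-1` O) c by rewrite OE /= -DE.
  by [].
have [d d0 dO] := nbhs_line (shift_direction c) (open_nbhs_nbhs (conj oO Oc)).
have [P P0 simpleP] := shift_simple c hn.
have dE : ((complex.Re d)%:C)%C = d by rewrite RRe_real// gtr0_real.
(* Real parameters [1 / (k + 1)] with [k >= N] have modulus less than [d]. *)
have [N /= dN] : exists N : nat, (complex.Re d)^-1 < N%:R.
  by exists (Num.truncn (complex.Re d)^-1).+1; rewrite truncnS_gt.
have [k Nk Pk] := small_nonroot N P0.
pose t : R := k.+1%:R^-1.
have tE : (t%:C)%C = k.+1%:R^-1 :> R[i] by rewrite fmorphV rmorph_nat.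
exists (to_dessins (shift c (t%:C)%C)); split.
  by apply: simpleP; rewrite tE.
apply: VU; suff : (@to_dessins R n @^-1` V) (shift c (t%:C)%C) by [].
rewrite -OE /= crtc_coef_shift; apply: dO.
have t0 : 0 < t by rewrite invr_gt0 ltr0n.
have Rd0 : 0 < complex.Re d by rewrite -ltcR dE.
rewrite normc_def /= expr0n addr0 sqrtr_sqr gtr0_norm// -dE ltcR.
rewrite invf_plt ?posrE ?ltr0n//; apply: lt_le_trans dN _.
by rewrite ler_nat (leq_trans Nk).
Qed.
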